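(* Let $\tilde\Omega\subset\mathbb R^N$ be a bounded open set with $0\in\tilde\Omega$, let $\tilde\Omega_1=\{x_N>0\}\cap\tilde\Omega$, $\tilde\Omega_2=\{x_N<0\}\cap\tilde\Omega$, $\tilde\Gamma=\{x_N=0\}\cap\tilde\Omega$, and for $0<h<t_0<T$ let $\tilde Q:=\tilde\Omega\times(t_0-h,t_0)$ and $\partial_p\tilde Q:=(\tilde\Omega\times\{t_0-h\})\cup(\partial\tilde\Omega\times[t_0-h,t_0])$. Assume that the dynamics $\tilde b_i$ and costs $\tilde l_i$, $i=1,2$, satisfy (C1)--(C4) (see context). If $\tilde u$ is a (bounded) usc subsolution and $\tilde v$ a (bounded) lsc supersolution of $w_t+\tilde{\mathbb H}^-(x,t,Dw)=0$ in $\tilde Q$, then $$\|(\tilde u-\tilde v)_+\|_{L^\infty(\tilde Q)}\le\|(\tilde u-\tilde v)_+\|_{L^\infty(\partial_p\tilde Q)}.$$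
   Context: Control data: for $i=1,2$, $\tilde b_i$ and $\tilde l_i$ are functions on (closure of $\tilde\Omega_i$)$\times[0,T]\times A_i$ with values in $\mathbb R^N$ and $\mathbb R$ respectively, satisfying: (C1) $A_i$ is a compact metric space, $\tilde b_i$ is continuous, $|\tilde b_i|\le\tilde M_b$ and $|\tilde b_i(z,s,\alpha_i)-\tilde b_i(z',s',\alpha_i)|\le\tilde L_b(|z-z'|+|s-s'|)$. (C2) $\tilde l_i$ is uniformly continuous, $|\tilde l_i|\le\tilde M_l$, and $|\tilde l_i(z,s,\alpha_i)-\tilde l_i(z',s',\alpha_i)|\le\tilde m_l(|z-z'|+|s-s'|)$ for a modulus of continuity $\tilde m_l$. (C3) For all $z,s$ the set $\{(\tilde b_i(z,s,\alpha_i),\tilde l_i(z,s,\alpha_i)):\alpha_i\in A_i\}$ is closed and convex. (C4) There is $\tilde\delta>0$ such that for $i=1,2$, $z\in\tilde\Gamma$, $s\in[0,T]$: $\{\tilde b_i(z,s,\alpha_i)\cdot\mathbf e_N:\alpha_i\in A_i\}\supset[-\tilde\delta,\tilde\delta]$, where $\mathbf e_N$ is the $N$-th unit vector (normal to $\tilde\Gamma$). Hamiltonians: $\tilde H_i(x,t,p)=\sup_{\alpha_i\in A_i}\{-\tilde b_i(x,t,\alpha_i)\cdot p-\tilde l_i(x,t,\alpha_i)\}$. With $A:=A_1\times A_2\times[0,1]$, $a=(\alpha_1,\alpha_2,\mu)$, for $z\in\tilde\Gamma$: $\tilde b_{\mathcal H}(z,s,a)=\mu\tilde b_1(z,s,\alpha_1)+(1-\mu)\tilde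 b_2(z,s,\alpha_2)$, $\tilde l_{\mathcal H}(z,s,a)=\mu\tilde l_1(z,s,\alpha_1)+(1-\mu)\tilde l_2(z,s,\alpha_2)$, $\tilde A_0(z,s)=\{a\in A:\tilde b_{\mathcal H}(z,s,a)\cdot\mathbf e_N=0\}$; for $p'\in\mathbb R^{N-1}$, identified with $(p',0)\in\mathbb R^N$, $\tilde H_T(z,s,p')=\sup_{a\in\tilde A_0(z,s)}\{-\tilde b_{\mathcal H}(z,s,a)\cdot(p',0)-\tilde l_{\mathcal H}(z,s,a)\}$. Sub/supersolutions of $w_t+\tilde{\mathbb H}^-(x,t,Dw)=0$ in $\tilde Q$: $\tilde u,\tilde v$ are bounded functions on the closure of $\tilde Q$, usc and lsc respectively. $\tilde u$ is a subsolution if, in the viscosity sense (local maxima of $\tilde u-\phi$ in $\tilde Q$, $\phi\in C^1$), $\tilde u_t+\tilde H_i(x,t,D\tilde u)\le0$ in $\tilde\Omega_i\times(t_0-h,t_0)$, $i=1,2$, $\tilde u_t+\min\{\tilde H_1,\tilde H_2\}(x,t,D\tilde u)\le0$ on $\tilde\Gamma\times(t_0-h,t_0)$, and in addition $\tilde u_t+\tilde H_T(x,t,D_{x'}\tilde u)\le0$ on $\tilde\Gamma\times(t_0-h,t_0)$, meaning that for every $C^1$ function $\phi(x',t)$ and every local maximum point $((x',0),t)$ of $\tilde u|_{\tilde\Gamma\times(t_0-h,t_0)}-\phi$ one has $\phi_t(x',t)+\tilde H_T((x',0),t,D_{x'}\phi(x',t))\le0$. $\tilde v$ is a supersolution if $\tilde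 v_t+\tilde H_i(x,t,D\tilde v)\ge0$ in $\tilde\Omega_i\times(t_0-h,t_0)$, $i=1,2$, and $\tilde v_t+\max\{\tilde H_1,\tilde H_2\}(x,t,D\tilde v)\ge0$ on $\tilde\Gamma\times(t_0-h,t_0)$ (local minima in $\tilde Q$); no tangential condition is required of $\tilde v$. Here $\|f\|_{L^\infty(E)}:=\sup_E|f|$ (pointwise supremum), $f_+=\max(f,0)$. *)

(* Defs.v *)
From HB Require Import structures.
From mathcomp Require Import all_boot all_order all_algebra.
From mathcomp Require Import all_classical all_reals all_analysis.

Set Implicit Arguments.
Unset Strict Implicit.
Unset Printing Implicit Defensive.

Import Order.TTheory GRing.Theory Num.Theory.
Import numFieldNormedType.Exports.

Local Open Scope classical_set_scope.
Local Open Scope ring_scope.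

(* The space R^N is 'rV[R]_(n + 1), i.e. N = n + 1, so that R^(N-1) is
   'rV[R]_n and p' |-> (p', 0) is a block row vector.  Space-time points are
   pairs in 'rV[R]_m * R.  Functions given on part of a space (the data b, l on
   closure Omega_i x [0, T] x A, and u, v on closure Q) are total functions
   whose values off that part are unconstrained. *)

Section Euclidean.
Context {R : realType}.

Definition dot {m} (x y : 'rV[R]_m) : R := \sum_i x 0 i * y 0 i.

(* The norm `|x| of the library on 'rV[R]_m is the sup norm; the estimates on
   the data are stated with the Euclidean norm. *)
Definition enorm {m} (x : 'rV[R]_m) : R := Num.sqrt (dot x x).

Definition eN {n} : 'rV[R]_(n + 1) := delta_mx 0 (rshift n ord0).

Definition tang {n} (p' : 'rV[R]_n) : 'rV[R]_(n + 1) := row_mx p' 0.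

Definition supnorm {T : Type} (E : set T) (f : T -> R) : R :=
  sup [set `|f z| | z in E].

Definition modulus (m : R -> R) : Prop :=
  [/\ m 0 = 0,
      forall r r', 0 <= r -> r <= r' -> m r <= m r'
    & m r @[r --> 0^'+] --> 0].

(* Off D the topology of [subspace D] is discrete, so only the restriction of f
   to D, with the relative topology, matters. *)
Definition lsc_on {X : topologicalType} (D : set X) (f : X -> R) : Prop :=
  lower_semicontinuous ((fun z => (f z)%:E) : subspace D -> \bar R).

Definition usc_on {X : topologicalType} (D : set X) (f : X -> R) : Prop :=
  lsc_on D (fun z => - f z).

End Euclidean.

Section Domain.
Context {R : realType} {n : nat}.
Implicit Types Omega : set 'rV[R]_(n + 1).

Definition Omega1 Omega := [set x | 0 < dot x eN] `&` Omega.
Definition Omega2 Omega := [set x | dot x eN < 0] `&` Omega.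
Definition Gamma Omega := [set x | dot x eN = 0] `&` Omega.

Definition bdry {X : topologicalType} (E : set X) := closure E `\` interior E.

Definition cyl {m} (E : set 'rV[R]_m) (t0 h : R) : set ('rV[R]_m * R) :=
  E `*` `]t0 - h, t0[.

Definition pbdry Omega (t0 h : R) : set ('rV[R]_(n + 1) * R) :=
  (Omega `*` [set t0 - h]) `|` (bdry Omega `*` `[t0 - h, t0]).

(* Gamma seen as an open subset of R^(N-1). *)
Definition Gamma' Omega : set 'rV[R]_n := [set x' | Gamma Omega (tang x')].

End Domain.

Section ControlData.
Context {R : realType} {n : nat} {A : metricType R}.
Local Notation V := 'rV[R]_(n + 1).
Implicit Types (E : set V) (T : R) (b : V -> R -> A -> V) (l : V -> R -> A -> R).

Definition cond_C1 E T b (Mb Lb : R) : Prop :=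
  [/\ compact [set: A],
      {within (E `*` `[0, T]) `*` [set: A],
         continuous (fun zsa : V * R * A => b zsa.1.1 zsa.1.2 zsa.2)},
      forall z s alpha, E z -> 0 <= s <= T -> enorm (b z s alpha) <= Mb
    & forall z s z' s' alpha, E z -> 0 <= s <= T -> E z' -> 0 <= s' <= T ->
        enorm (b z s alpha - b z' s' alpha)
          <= Lb * (enorm (z - z') + `|s - s'|)].

Definition cond_C2 E T l (Ml : R) (ml : R -> R) : Prop :=
  [/\ unif_continuous ((fun zsa : V * R * A => l zsa.1.1 zsa.1.2 zsa.2)
         : subspace ((E `*` `[0, T]) `*` [set: A]) -> R),
      forall z s alpha, E z -> 0 <= s <= T -> `|l z s alpha| <= Ml
    & forall z s z' s' alpha, E z -> 0 <= s <= T -> E z' -> 0 <= s' <= T ->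
        `|l z s alpha - l z' s' alpha| <= ml (enorm (z - z') + `|s - s'|)].

Definition cond_C3 E T b l : Prop :=
  forall z s, E z -> 0 <= s <= T ->
    let BL : set (V * R) := [set (b z s alpha, l z s alpha) | alpha in setT] in
    closed BL /\ convex_set BL.

Definition cond_C4 E T b (delta : R) : Prop :=
  forall z s, E z -> 0 <= s <= T ->
    `[- delta, delta] `<=` [set dot (b z s alpha) eN | alpha in setT].

Definition hamiltonian b l (x : V) (t : R) (p : V) : R :=
  sup [set - dot (b x t alpha) p - l x t alpha | alpha in setT].

End ControlData.

Section TangentialHamiltonian.
Context {R : realType} {n : nat} {A1 A2 : metricType R}.
Local Notation V := 'rV[R]_(n + 1).
Variables (b1 : V -> R -> A1 -> V) (b2 : V -> R -> A2 -> V).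
Variables (l1 : V -> R -> A1 -> R) (l2 : V -> R -> A2 -> R).
Implicit Types a : A1 * A2 * R.

Definition bH (z : V) (s : R) a : V :=
  a.2 *: b1 z s a.1.1 + (1 - a.2) *: b2 z s a.1.2.

Definition lH (z : V) (s : R) a : R :=
  a.2 * l1 z s a.1.1 + (1 - a.2) * l2 z s a.1.2.

Definition A0 (z : V) (s : R) : set (A1 * A2 * R) :=
  [set a | 0 <= a.2 <= 1 /\ dot (bH z s a) eN = 0].

Definition HT (z : V) (s : R) (p' : 'rV[R]_n) : R :=
  sup [set - dot (bH z s a) (tang p') - lH z s a | a in A0 z s].

End TangentialHamiltonian.

Section Viscosity.
Context {R : realType} {m : nat}.
Local Notation X := ('rV[R]_m * R)%type.
Implicit Types (Q E : set X) (u phi : X -> R)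
  (H : 'rV[R]_m -> R -> 'rV[R]_m -> R).

Definition time_deriv phi (z : X) : R := 'D_((0, 1) : X) phi z.

Definition space_grad phi (z : X) : 'rV[R]_m :=
  \row_i 'D_((delta_mx 0 i, 0) : X) phi z.

(* In finite dimension, continuity of every directional derivative amounts to
   continuity of the differential. *)
Definition C1_on Q phi : Prop := forall z, Q z ->
  differentiable phi z /\ forall v : X, {for z, continuous ('D_v phi)}.

Definition local_max Q u (z : X) : Prop :=
  \forall y \near within Q (nbhs z), u y <= u z.

Definition local_min Q u (z : X) : Prop :=
  \forall y \near within Q (nbhs z), u z <= u y.

(* u_t + H(x, t, Du) <= 0 at the points of E in the viscosity sense, with local
   maxima relative to the open set Q containing E. *)
Definition visc_sub Q E H u : Prop := forall phi, C1_on Q phi ->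
  forall z, E z -> local_max Q (u \- phi) z ->
    time_deriv phi z + H z.1 z.2 (space_grad phi z) <= 0.

Definition visc_super Q E H u : Prop := forall phi, C1_on Q phi ->
  forall z, E z -> local_min Q (u \- phi) z ->
    0 <= time_deriv phi z + H z.1 z.2 (space_grad phi z).

End Viscosity.

Section SubSuperSolutions.
Context {R : realType} {n : nat} {A1 A2 : metricType R}.
Local Notation V := 'rV[R]_(n + 1).
Variables (Omega : set V) (t0 h : R).
Variables (b1 : V -> R -> A1 -> V) (b2 : V -> R -> A2 -> V).
Variables (l1 : V -> R -> A1 -> R) (l2 : V -> R -> A2 -> R).

Let H1 := hamiltonian b1 l1.
Let H2 := hamiltonian b2 l2.
Let Q := cyl Omega t0 h.

Definition subsolution (u : V * R -> R) : Prop :=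
  [/\ visc_sub Q (cyl (Omega1 Omega) t0 h) H1 u,
      visc_sub Q (cyl (Omega2 Omega) t0 h) H2 u,
      visc_sub Q (cyl (Gamma Omega) t0 h)
        (fun x t p => Num.min (H1 x t p) (H2 x t p)) u
    & visc_sub (cyl (Gamma' Omega) t0 h) (cyl (Gamma' Omega) t0 h)
        (fun x' t p' => HT b1 b2 l1 l2 (tang x') t p')
        (fun z => u (tang z.1, z.2))].

Definition supersolution (v : V * R -> R) : Prop :=
  [/\ visc_super Q (cyl (Omega1 Omega) t0 h) H1 v,
      visc_super Q (cyl (Omega2 Omega) t0 h) H2 v
    & visc_super Q (cyl (Gamma Omega) t0 h)
        (fun x t p => Num.max (H1 x t p) (H2 x t p)) v].

End SubSuperSolutions.

(* Main.v *)
(* Suppose that u - v exceeds its bound on the parabolic boundary.  Subtracting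
   c / (t0 - t) and a quadratic from u produces a strict subsolution such that u - v
   has a strict maximum at some Z1 inside the cylinder.

   If Z1 is off the interface, doubling the variables concludes.  On the interface
   the Hamiltonians are coercive in the normal direction only, so the doubling is
   done in two stages.  First the tangential variables and the time are doubled, but
   not the normal one; this freezes a tangential jet p.  If the maximum point lies on
   the interface, the tangential inequality and the duality
   H_T(p) = min_s max(H_1, H_2)(p + s e_N) give a slope s at which both Hamiltonians
   satisfy the strict inequality.  Then the normal variable is doubled with the
   penalization (x_N - k(y_N))^2 / kappa, where k is close to the identity and
   k'(0) = 0: the normal slopes seen by u and v are s + g and s + k'(y_N) g.  If
   y_N = 0, then v is tested at the slope s.  If x_N and y_N have the same sign,
   convexity interpolates between s and s + g.  Otherwise coercivity bounds g, hence
   k(y_N) = O(kappa) and k'(y_N) g is small.  Each case contradicts the supersolution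
   inequality. *)
Require Import Defs.
From HB Require Import structures.
From mathcomp Require Import all_boot all_order all_algebra.
From mathcomp Require Import all_classical all_reals all_analysis.
From mathcomp Require Import ring lra.
Import Order.TTheory GRing.Theory Num.Theory.
Import numFieldNormedType.Exports.
Local Open Scope classical_set_scope.
Local Open Scope ring_scope.

Set Implicit Arguments.
Unset Strict Implicit.
Unset Printing Implicit Defensive.

(** * Semicontinuous maxima *)

(** The obstacle is that the two points of a doubling may lie on opposite sides of the interface,
    where the inequalities for [u] and [v] concern unrelated Hamiltonians, and that on the interface
    each of them holds for one unspecified side. Comparison is possible only at a slope where both
    Hamiltonians are negative. Such a slope [s] depends on the tangential jet [p], so [p] has to be
    fixed before the normal penalization can be centred at [s]; a single doubling would let [p] vary
    with it. With [k] the identity, [v] would be tested at [s + g], and [g] is bounded but need not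
    be small: this is why the slope of [v] is damped. No function is both flat and close to the
    identity everywhere, but it is enough that [k'] is small wherever [k] is. Parameters are fixed
    in this order: the radius around [Z1], the tangential parameter [c] and with it [p], the
    tolerance [w] for perturbed jets, and last the scale of the bent penalization. *)

Definition usc_within {R : realType} {X : topologicalType} (K : set X)
    (f : X -> R) : Prop :=
  forall x, K x -> forall e, 0 < e ->
    \forall y \near within K (nbhs x), f y < f x + e.

(** [X] is an arbitrary topological space, so convergent subsequences are replaced by arbitrarily
    late returns to each neighbourhood. *)
Lemma compact_seq_cluster {X : topologicalType} (K : set X) (p : nat -> X) :
  compact K -> (forall k, K (p k)) ->
  exists2 x, K x & forall U, nbhs x U -> forall N, exists2 k, (N <= k)%N & U (p k).
Proof.
move=> Kc Kp; have KF : (p @ \oo) K by exists 0%N => // k _; exact: Kp.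
have [x [Kx cx]] : K `&` cluster (p @ \oo) !=set0 by exact: Kc.
exists x => // U Ux N.
have NF : (p @ \oo) [set y | exists2 k, (N <= k)%N & y = p k].
  by exists N => // k /= Nk; exists k.
by have [y [[k Nk ->] Uy]] := cx _ _ NF Ux; exists k.
Qed.

Lemma usc_compact_max {R : realType} {X : topologicalType} (K : set X) (f : X -> R) :
  compact K -> K !=set0 -> usc_within K f ->
  exists2 x, K x & forall y, K y -> f y <= f x.
Proof.
move=> Kc [x0 Kx0] fu.
have cl (p : nat -> X) : (forall k, K (p k)) -> exists2 x, K x &
    forall e, 0 < e -> forall N, exists2 k, (N <= k)%N & f (p k) < f x + e.
  move=> Kp; have [x Kx cx] := compact_seq_cluster Kc Kp.
  exists x => // e e0 N; have [k Nk] := cx _ (fu x Kx e e0) N.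
  by move=> /(_ (Kp k)) ?; exists k.
have fb : has_ubound [set f y | y in K].
  apply: contrapT => nb.
  have pk k : exists y, K y /\ k%:R < f y.
    apply: contrapT => nk; apply: nb; exists k%:R => _ [y Ky <-].
    by rewrite leNgt; apply/negP => ky; apply: nk; exists y.
  have [p Hp] := choice pk.
  have [x Kx cx] := cl p (fun k => (Hp k).1).
  have [k Nk] := cx 1 ltr01 (Num.bound `|f x + 1|).
  rewrite ltNge => /negP; apply; apply: le_trans (ltW (Hp k).2).
  apply: le_trans (ler_norm _) _; apply: le_trans (ltW (archi_boundP _)) _ => //.
  by rewrite ler_nat.
have fs : has_sup [set f y | y in K] by split=> //; exists (f x0), x0.
have pk (k : nat) : exists y, K y /\ sup [set f y | y in K] - k.+1%:R^-1 < f y.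
  have [_ [y Ky <-] ?] := sup_adherent (ltac:(by rewrite invr_gt0) : 0 < k.+1%:R^-1 :> R) fs.
  by exists y.
have [p Hp] := choice pk.
have [x Kx cx] := cl p (fun k => (Hp k).1).
exists x => // y Ky; apply/ler_addgt0Pr => e e0.
have e20 : 0 < e / 2 by rewrite divr_gt0.
have [k Nk fk] := cx _ e20 (Num.bound (e / 2)^-1).
have ke : k.+1%:R^-1 <= e / 2.
  rewrite invf_ple ?posrE //; apply: le_trans (ltW (archi_boundP _)) _.
    by rewrite invr_ge0 ltW.
  by rewrite ler_nat (leq_trans Nk).
have := (Hp k).2; have : f y <= sup [set f y | y in K].
  by apply: ub_le_sup => //; exists y.
move: fk ke; set d := k.+1%:R^-1; set S := sup _; set g := f (p k) => h1 h2 h3 h4; lra.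
Qed.

(* Almost maximisers of [f - P / eps] concentrate, as [eps] tends to 0, at the
   strict maximum point of [f] on the zero set of [P]. *)
Lemma penalization {R : realType} {X : topologicalType} (K : set X)
    (f P : X -> R) (p0 : X) (U : set X) :
  compact K -> usc_within K f -> continuous P -> (forall x, 0 <= P x) ->
  (forall x, K x -> P x = 0 -> f p0 <= f x -> x = p0) -> nbhs p0 U ->
  exists2 e0, 0 < e0 & forall e, 0 < e -> e <= e0 ->
    forall x, K x -> f p0 - e <= f x - P x / e -> U x.
Proof.
move=> Kc fu Pc P0 p0max p0U; apply: contrapT => H.
have pk (k : nat) : exists y, [/\ K y, f p0 - k.+1%:R^-1 <= f y - P y * k.+1%:R & ~ U y].
  apply: contrapT => nk; apply: H; exists k.+1%:R^-1; first by rewrite invr_gt0.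
  (* The failure occurs at some [e] below [1 / (k + 1)]; replacing it by this value weakens the
     inequality on both sides and leaves a penalty weight depending on [k] alone. *)
  move=> e e0 ek y Ky fy; apply: contrapT => nUy; apply: nk; exists y; split => //.
  have : P y * k.+1%:R <= P y / e.
    by rewrite ler_wpM2l // -[leLHS]invrK lef_pV2 ?posrE ?invr_gt0.
  move: ek fy; set d := k.+1%:R^-1; set m := P y * _; lra.
have [p Hp] := choice pk.
have Kp k : K (p k) by case: (Hp k).
have [x Kx cx] := compact_seq_cluster Kc Kp.
have fx : f p0 <= f x.
  apply/ler_addgt0Pr => e e0.
  have e20 : 0 < e / 2 by rewrite divr_gt0.
  have [k Nk fk] := cx _ (fu x Kx _ e20) (Num.bound (e / 2)^-1).
  have ke : k.+1%:R^-1 <= e / 2.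
    rewrite invf_ple ?posrE //; apply: le_trans (ltW (archi_boundP _)) _.
      by rewrite invr_ge0 ltW.
    by rewrite ler_nat (leq_trans Nk).
  have := fk (Kp k); have [_ + _] := Hp k.
  have : 0 <= P (p k) * k.+1%:R by rewrite mulr_ge0.
  move: ke; set d := k.+1%:R^-1; set m := P (p k) * _; lra.
have Px : P x = 0.
  apply: contrapT => Px; have {}Px : 0 < P x by rewrite lt_neqAle P0 andbT eq_sym; apply/eqP.
  have P20 : 0 < P x / 2 by rewrite divr_gt0.
  have nP : \forall y \near x, P x / 2 < P y.
    have /cvgr_gt := Pc x; apply; lra.
  (* At this rank [P x / 2 * k.+1%:R] exceeds [f x + 2 - f p0], while [f (p k) < f x + 1] and the
     tolerance is at most 1. *)
  have [k Nk [Pk fk]] := cx _ (filterI nP (fu x Kx _ ltr01))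
    (Num.bound `|2 / P x * (f x + 2 - f p0)|).
  have := fk (Kp k); have [_ + _] := Hp k.
  have k1 : (k.+1%:R : R)^-1 <= 1 by rewrite invf_le1 // ler1n.
  have : 2 / P x * (f x + 2 - f p0) < k.+1%:R.
    apply: le_lt_trans (ler_norm _) _; apply: lt_le_trans (archi_boundP _) _ => //.
    by rewrite ler_nat (leq_trans Nk).
  rewrite mulrAC ltr_pdivrMr // => H1.
  have : P x / 2 * k.+1%:R <= P (p k) * k.+1%:R by rewrite ler_wpM2r // ltW.
  move: k1 H1; set d := k.+1%:R^-1; set m := P (p k) * _; set j := k.+1%:R; lra.
have xp0 := p0max x Kx Px fx.
have [k _ Uk] := cx U (ltac:(by rewrite xp0)) 0%N.
by case: (Hp k).
Qed.

(** * The Euclidean structure of space-time, and quadratic superjets *)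

Section Dot.
Context {R : realType} {m : nat}.
Implicit Types x y z : 'rV[R]_m.

Lemma dotC x y : dot x y = dot y x.
Proof. by apply: eq_bigr => i _; rewrite mulrC. Qed.

Lemma dotDl x y z : dot (x + y) z = dot x z + dot y z.
Proof. by rewrite -big_split; apply: eq_bigr => i _; rewrite mxE mulrDl. Qed.

Lemma dotZl (c : R) x y : dot (c *: x) y = c * dot x y.
Proof. by rewrite mulr_sumr; apply: eq_bigr => i _; rewrite mxE mulrA. Qed.

Lemma dotDr x y z : dot z (x + y) = dot z x + dot z y.
Proof. by rewrite dotC dotDl !(dotC z). Qed.

Lemma dotZr (c : R) x y : dot y (c *: x) = c * dot y x.
Proof. by rewrite dotC dotZl (dotC y). Qed.

Lemma dotNl x y : dot (- x) y = - dot x y.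
Proof. by rewrite -scaleN1r dotZl mulN1r. Qed.

Lemma dotNr x y : dot y (- x) = - dot y x.
Proof. by rewrite dotC dotNl dotC. Qed.

Lemma coord_le_norm x i : `|x 0 i| <= `|x|.
Proof.
rewrite [leRHS]mx_normrE.
by apply: (le_trans _ (le_bigmax _ _ (0, i))).
Qed.

Lemma norm_le_coord x c : 0 <= c -> (forall i, `|x 0 i| <= c) -> `|x| <= c.
Proof.
move=> c0 H; rewrite [leLHS]mx_normrE; apply/bigmax_leP; split => // -[j i] _ /=.
by rewrite (ord1 j).
Qed.

Lemma dot_ge0 x : 0 <= dot x x.
Proof. by apply: sumr_ge0 => i _; rewrite -expr2 sqr_ge0. Qed.

(** [|x|] is the sup norm: the [m] products are bounded one by one, which costs the factor [m]. *)
Lemma dot_le_norm x y : `|dot x y| <= m%:R * `|x| * `|y|.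
Proof.
apply: le_trans (ler_norm_sum _ _ _) _.
have -> : m%:R * `|x| * `|y| = \sum_(i < m) `|x| * `|y|.
  by rewrite sumr_const card_ord -mulrA mulr_natl.
by apply: ler_sum => i _; rewrite normrM ler_pM // coord_le_norm.
Qed.

Lemma coord_sqr_le_dot x i : x 0 i ^+ 2 <= dot x x.
Proof.
rewrite /dot (bigD1 i) //= -expr2 lerDl.
by apply: sumr_ge0 => j _; rewrite -expr2 sqr_ge0.
Qed.

Lemma enorm_ge0 x : 0 <= enorm x.
Proof. exact: sqrtr_ge0. Qed.

Lemma norm_le_enorm x : `|x| <= enorm x.
Proof.
apply: norm_le_coord => [|i]; first exact: enorm_ge0.
rewrite -sqrtr_sqr; apply: ler_wsqrtr; exact: coord_sqr_le_dot.
Qed.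

Lemma enorm_le_norm x : enorm x <= m%:R * `|x|.
Proof.
rewrite -[leRHS]ger0_norm ?mulr_ge0 // -sqrtr_sqr ler_wsqrtr //.
apply: le_trans (ler_norm _) _; apply: le_trans (dot_le_norm _ _) _.
rewrite exprMn -mulrA -expr2 ler_wpM2r ?sqr_ge0 //.
rewrite -natrX ler_nat; case: (m) => // k; by rewrite -[leqLHS]expn1 leq_pexp2l.
Qed.

End Dot.

(* Jets are space-time vectors [(p, tau)], with [p] the space gradient and [tau] the
   time derivative. *)
Section SpaceTime.
Context {R : realType} {m : nat}.
Local Notation X := ('rV[R]_m * R)%type.
Implicit Types P W Z A : X.

Definition pd P W : R := dot P.1 W.1 + P.2 * W.2.

Lemma pdC P W : pd P W = pd W P.
Proof. by rewrite /pd dotC mulrC. Qed.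

Lemma pdDl P W A : pd (P + W) A = pd P A + pd W A.
Proof. by rewrite /pd /= dotDl mulrDl addrACA. Qed.

Lemma pdDr P W A : pd A (P + W) = pd A P + pd A W.
Proof. by rewrite pdC pdDl !(pdC A). Qed.

Lemma pdZl c P W : pd (c *: P) W = c * pd P W.
Proof. by rewrite /pd /= dotZl mulrDr mulrA. Qed.

Lemma pdZr c P W : pd P (c *: W) = c * pd P W.
Proof. by rewrite pdC pdZl pdC. Qed.

Lemma pdNl P W : pd (- P) W = - pd P W.
Proof. by rewrite -scaleN1r pdZl mulN1r. Qed.

Lemma pdNr P W : pd P (- W) = - pd P W.
Proof. by rewrite pdC pdNl pdC. Qed.

Lemma pd0l W : pd 0 W = 0.
Proof. by rewrite -(scale0r 0) pdZl mul0r. Qed.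

Definition pdE := (pdDl, pdDr, pdZl, pdZr, pdNl, pdNr).

Lemma pd_ge0 W : 0 <= pd W W.
Proof. by rewrite addr_ge0 ?dot_ge0 // -expr2 sqr_ge0. Qed.

Lemma pd_le_norm P W : `|pd P W| <= m.+1%:R * `|P| * `|W|.
Proof.
rewrite -natr1 2!mulrDl mul1r; apply: le_trans (ler_normD _ _) _.
have fst W' : `|W'.1| <= `|W'| by rewrite prod_normE le_max lexx.
have snd W' : `|W'.2| <= `|W'| by rewrite prod_normE le_max lexx orbT.
apply: lerD; last by rewrite normrM ler_pM.
apply: le_trans (dot_le_norm _ _) _.
by rewrite -!mulrA ler_wpM2l // ler_pM.
Qed.

Lemma norm_sqr_le_pd W : `|W| ^+ 2 <= pd W W.
Proof.
have : `|W| <= Num.sqrt (pd W W).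
  rewrite prod_normE ge_max; apply/andP; split.
    apply: le_trans (norm_le_enorm _) _; rewrite ler_wsqrtr // lerDl.
    by rewrite -expr2 sqr_ge0.
  by rewrite -sqrtr_sqr ler_wsqrtr // /pd -expr2 lerDr dot_ge0.
by move=> H; rewrite -[leRHS]sqr_sqrtr ?pd_ge0 // ler_pXn2r ?nnegrE.
Qed.

Lemma pd_eq0 W : pd W W = 0 -> W = 0.
Proof.
move=> W0; apply/eqP; rewrite -normr_le0 -[leRHS](expr0n _ 1).
have := norm_sqr_le_pd W; rewrite W0 => H.
by rewrite leNgt; apply/negP => ?; move: H; rewrite leNgt exprn_gt0.
Qed.

(** The remainder is quadratic rather than little-o: the penalizations below satisfy such a bound,
    and the bound is itself a smooth test function. A subjet [P] of [v] is expressed as the superjet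
    [- P] of [- v]. *)
Definition superjet (D : set X) (u : X -> R) Z P : Prop :=
  exists C, \forall Z' \near within D (nbhs Z),
    u Z' <= u Z + pd P (Z' - Z) + C * pd (Z' - Z) (Z' - Z).

Lemma superjetD D u w Z P P' :
  superjet D u Z P -> superjet D w Z P' -> superjet D (u \+ w) Z (P + P').
Proof.
move=> [C uC] [C' wC']; exists (C + C').
apply: filterS2 uC wC' => Z' H H' /=.
by rewrite pdDl; lra.
Qed.

Lemma superjetZ D u Z P c : 0 <= c -> superjet D u Z P ->
  superjet D (fun W => c * u W) Z (c *: P).
Proof.
move=> c0 [C uC]; exists (c * C); apply: filterS uC => Z' H.
by rewrite pdZl -!mulrA -!mulrDr ler_wpM2l.
Qed.

(** This is how maxima produce jets: the penalization [w] plays the part of the test function. *)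
Lemma superjet_sub D u w Z P : superjet D w Z P ->
  (\forall Z' \near within D (nbhs Z), u Z' - w Z' <= u Z - w Z) ->
  superjet D u Z P.
Proof.
move=> [C wC] uw; exists C; apply: filterS2 uw wC => Z' H H'; lra.
Qed.

Lemma superjet_lin D A Z : superjet D (fun W => pd W A) Z A.
Proof.
exists 0; apply: nearW => Z'; rewrite mul0r addr0 pdDr pdNr !(pdC A); lra.
Qed.

Lemma superjet_sq D A Z :
  superjet D (fun W => pd (W - A) (W - A)) Z (2 *: (Z - A)).
Proof.
exists 1; apply: nearW => Z'.
by rewrite !pdE (pdC A Z) (pdC A Z') (pdC Z' Z) le_eqVlt; apply/orP; left; apply/eqP; ring.
Qed.

(** The function is exactly quadratic. A negative [c] is allowed, as needed to remove the normal
    part of a square; hence [|c|] in the remainder. *)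
Lemma superjet_lin_sq D A (k c : R) Z :
  superjet D (fun W => c * (pd W A - k) ^+ 2) Z ((2 * c * (pd Z A - k)) *: A).
Proof.
exists (`|c| * (m.+1%:R * `|A|) ^+ 2); apply: nearW => Z'.
have -> : c * (pd Z' A - k) ^+ 2 = c * (pd Z A - k) ^+ 2 +
    pd ((2 * c * (pd Z A - k)) *: A) (Z' - Z) + c * pd (Z' - Z) A ^+ 2.
  by rewrite !pdE !(pdC A); ring.
rewrite lerD2l; apply: le_trans (ler_norm _) _.
rewrite normrM -mulrA ler_wpM2l // normrX.
apply: (@le_trans _ _ ((m.+1%:R * `|A| * `|Z' - Z|) ^+ 2)).
  by rewrite ler_pXn2r ?nnegrE ?mulr_ge0 // pdC pd_le_norm.
by rewrite exprMn ler_wpM2l ?sqr_ge0 // norm_sqr_le_pd.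
Qed.

End SpaceTime.

(** * Stability of upper semicontinuity, continuity of the pairings *)

Section UscCombinators.
Context {R : realType} {X Y : topologicalType}.

Lemma usc_withinD (K : set X) (f g : X -> R) :
  usc_within K f -> usc_within K g -> usc_within K (f \+ g).
Proof.
move=> fu gu x Kx e e0; have e20 : 0 < e / 2 by rewrite divr_gt0.
by apply: filterS2 (fu x Kx _ e20) (gu x Kx _ e20) => y /= ? ?; lra.
Qed.

Lemma usc_within_continuous (K : set X) (f : X -> R) :
  continuous f -> usc_within K f.
Proof.
move=> fc x Kx e e0; have /cvgr_lt H := fc x.
have : f x < f x + e by lra.
by move=> /H; apply: filterS.
Qed.

Lemma usc_within_comp (K : set X) (K' : set Y) (f : X -> R) (h : Y -> X) :
  usc_within K f -> continuous h -> (forall y, K' y -> K (h y)) ->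
  usc_within K' (f \o h).
Proof.
move=> fu hc hK y Ky e e0.
have : \forall z \near y, K (h z) -> f (h z) < f (h y) + e.
  exact: hc y _ (fu _ (hK y Ky) e e0).
by apply: filterS => z H /hK; exact: H.
Qed.

Lemma usc_withinW (K K' : set X) (f : X -> R) :
  K' `<=` K -> usc_within K f -> usc_within K' f.
Proof.
move=> KK fu x /KK Kx e /(fu x Kx e) H.
have {}H : \forall y \near x, K y -> f y < f x + e := H.
by apply: filterS H => y H /KK.
Qed.

End UscCombinators.

Lemma continuous_fst {X Y : topologicalType} : continuous (fst : X * Y -> X).
Proof. by move=> p; exact: cvg_fst. Qed.

Lemma continuous_snd {X Y : topologicalType} : continuous (snd : X * Y -> Y).
Proof. by move=> p; exact: cvg_snd. Qed.

Section Continuity.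
Context {R : realType} {m : nat} {T : topologicalType}.
Local Notation X := ('rV[R]_m * R)%type.

Lemma continuous_dot (f g : T -> 'rV[R]_m) :
  continuous f -> continuous g -> continuous (fun z => dot (f z) (g z)).
Proof.
move=> fc gc z; apply: cvg_big => [|i _]; first exact: add_continuous.
have cc (k : T -> 'rV[R]_m) : continuous k -> k y 0 i @[y --> z] --> k z 0 i.
  by move=> kc; apply: (@continuous_comp _ _ _ k (fun x : 'rV[R]_m => x 0 i)); [exact: kc | exact: coord_continuous].
by apply: cvgM; exact: cc.
Qed.

Lemma continuous_pd (f g : T -> X) :
  continuous f -> continuous g -> continuous (fun z => pd (f z) (g z)).
Proof.
move=> fc gc z; apply: cvgD.
  apply: continuous_dot => y.
    exact: (@cvg_comp _ _ _ f fst _ _ _ (fc y) cvg_fst).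
  exact: (@cvg_comp _ _ _ g fst _ _ _ (gc y) cvg_fst).
apply: cvgM.
  exact: (@cvg_comp _ _ _ f snd _ _ _ (fc z) cvg_snd).
exact: (@cvg_comp _ _ _ g snd _ _ _ (gc z) cvg_snd).
Qed.

End Continuity.

Lemma near_norm_lt {R : realType} {V : normedModType R} (x c : V) (r : R) :
  `|x - c| < r -> \forall y \near x, `|y - c| < r.
Proof.
move=> H; have /cvgr_norm_lt : (fun y => y - c) @ x --> x - c.
  by apply: cvgB; [exact: cvg_id | exact: cvg_cst].
exact.
Qed.

Definition cball {R : realType} {V : normedModType R} (c : V) (r : R) : set V :=
  [set x | `|x - c| <= r].

(** * Comparison away from the interface *)

Section Interior.
Context {R : realType} {m : nat}.
Local Notation X := ('rV[R]_m * R)%type.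
Implicit Types P Z Y : X.

Lemma cball_compact Z (r : R) : 0 < r -> compact (cball Z r).
Proof.
move=> r0; have -> : cball Z r = (cball Z.1 r `*` cball Z.2 r).
  apply/seteqP; split=> [W|W [W1 W2]] /=; rewrite /cball /= prod_normE ge_max.
    by move=> /andP[].
  by apply/andP; split.
apply: compact_setX.
  apply: bounded_closed_compact.
    exists (r + `|Z.1|); split; first by rewrite num_real.
    move=> M rM x /= xZ; rewrite -[x](subrK Z.1).
    by apply: le_trans (ler_normD _ _) _; move: xZ; rewrite /cball /=; lra.
  rewrite (_ : cball _ _ = closed_ball Z.1 r); first exact: closed_ball_closed.
  by rewrite closed_ballE //; apply/seteqP; split => x /=; rewrite /closed_ball_ /cball /= distrC.
rewrite (_ : cball _ _ = closed_ball Z.2 r); first exact: closed_ballR_compact.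
by rewrite closed_ballE //; apply/seteqP; split => x /=; rewrite /closed_ball_ /cball /= distrC.
Qed.

(** Classical doubling with the penalty [S / c]. Both functions see the same jet
    [P = 2 (Z - Y) / c], so the Lipschitz error is [2 L |Z - Y|^2 / c], which concentration makes
    small. *)
Lemma interior_comparison (F : X -> X -> R) (u v : X -> R) Z1 (r eta L : R)
    (mu : R -> R) :
  0 < r -> 0 < eta -> 0 <= L ->
  (forall e : R, 0 < e -> exists2 d : R, 0 < d & forall s : R, 0 <= s -> s < d -> mu s <= e) ->
  (forall Z Y P, cball Z1 r Z -> cball Z1 r Y ->
     F Z P <= F Y P + L * `|Z - Y| * `|P| + mu `|Z - Y|) ->
  usc_within (cball Z1 r) u -> usc_within (cball Z1 r) (fun Z => - v Z) ->
  (forall Z, cball Z1 r Z -> u Z1 - v Z1 <= u Z - v Z -> Z = Z1) ->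
  (forall Z P, `|Z - Z1| < r -> superjet setT u Z P -> F Z P <= - eta) ->
  (forall Z P, `|Z - Z1| < r -> superjet setT (fun W => - v W) Z (- P) -> 0 <= F Z P) ->
  False.
Proof.
move=> r0 eta0 L0 muP FL uu vu uvmax usub vsup.
set B := cball Z1 r; pose K := B `*` B.
have Kc : compact K by apply: compact_setX; exact: cball_compact.
have BZ1 : B Z1 by rewrite /B /cball /= subrr normr0 ltW.
pose f (p : X * X) := u p.1 - v p.2.
pose S (p : X * X) := pd (p.1 - p.2) (p.1 - p.2).
have fu : usc_within K f.
  apply: (@usc_withinD _ _ _ (u \o fst) ((fun Z => - v Z) \o snd)).
    have Kfst (p : X * X) (Kp : K p) : B p.1 := proj1 Kp.
  exact: usc_within_comp uu (@continuous_fst X X) Kfst.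
  have Ksnd (p : X * X) (Kp : K p) : B p.2 := proj2 Kp.
  exact: usc_within_comp vu (@continuous_snd X X) Ksnd.
have dc : continuous (fun p : X * X => p.1 - p.2).
  by move=> p; apply: cvgB; [exact: cvg_fst | exact: cvg_snd].
have Sc : continuous S by exact: continuous_pd.
(* The Lipschitz error will be at most [2 L e], hence at most [eta / 4]; the modulus takes another
   [eta / 4], and the strictness [eta] is not exhausted. *)
pose e := eta / (8 * (L + 1)).
have e0 : 0 < e by rewrite divr_gt0 // mulr_gt0 //; lra.
have eL : 8 * (L * e) <= eta.
  have L1 : 0 < L + 1 by lra.
  have -> : 8 * (L * e) = eta * (L / (L + 1)) by rewrite /e; field; lra.
  by rewrite ler_piMr ?ltW // ltr_pdivrMr //; lra.
have [d d0 dP] := muP (eta / 4) (ltac:(by rewrite divr_gt0)).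
(* The bound on [f] is part of [U]: besides the closeness of the points, it makes the penalty term
   smaller than [e]. *)
pose U := [set p : X * X | [/\ K p -> f p < f (Z1, Z1) + e,
  `|p.1 - Z1| < Num.min r (d / 2) & `|p.2 - Z1| < Num.min r (d / 2)]].
have rd0 : 0 < Num.min r (d / 2) by rewrite lt_min r0 divr_gt0.
have Z1rd : `|Z1 - Z1| < Num.min r (d / 2) by rewrite subrr normr0.
have UZ : nbhs (Z1, Z1) U.
  have H1 : nbhs (Z1, Z1) (fun p : X * X => `|p.1 - Z1| < Num.min r (d / 2)).
    exact: (@continuous_fst X X (Z1, Z1) _ (near_norm_lt Z1rd)).
  have H2 : nbhs (Z1, Z1) (fun p : X * X => `|p.2 - Z1| < Num.min r (d / 2)).
    exact: (@continuous_snd X X (Z1, Z1) _ (near_norm_lt Z1rd)).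
  have H3 := fu (Z1, Z1) (conj BZ1 BZ1) e e0.
  apply: filterS (filterI H1 (filterI H2 H3)) => p [h1 [h2 h3]].
  exact: And3 h3 h1 h2.
have Smax p : K p -> S p = 0 -> f (Z1, Z1) <= f p -> p = (Z1, Z1).
  case: p => Z Y [/= BZ BY] /pd_eq0/eqP; rewrite subr_eq0 => /eqP /= ZY.
  by rewrite -{}ZY /f /= => /(uvmax _ BZ) ->.
have S0 p : 0 <= S p by exact: pd_ge0.
have [c c0 cP] := penalization Kc fu Sc S0 Smax UZ.
pose g p := f p - c^-1 * S p.
have gu : usc_within K g.
  apply: usc_withinD fu _; apply: usc_within_continuous => p.
  by apply: cvgN; apply: cvgMr; exact: Sc.
have [[Z Y] KZY ZYmax] := usc_compact_max Kc (ex_intro _ (Z1, Z1) (conj BZ1 BZ1)) gu.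
have g0 : f (Z1, Z1) <= f (Z, Y) - S (Z, Y) / c.
  have := ZYmax (Z1, Z1) (conj BZ1 BZ1).
  by rewrite /g {1}/S /= subrr pd0l mulr0 subr0 (mulrC c^-1).
have UZY : U (Z, Y) by apply: (cP c) => //; lra.
have [BZ BY] := KZY; move: UZY => [/(_ KZY) fe /=]; rewrite !lt_min.
move=> /andP[Zr Zd] /andP[Yr Yd].
have Z2 : B Z by exact: ltW.
pose P : X := (2 * c^-1) *: (Z - Y).
have ci : 0 <= c^-1 by rewrite invr_ge0 ltW.
have uP : F Z P <= - eta.
  apply: usub => //; rewrite /P mulrC -scalerA.
  apply: superjet_sub (superjetZ ci (superjet_sq setT Y Z)) _.
  apply: filterS (near_norm_lt Zr) => W Wr _.
  by have := ZYmax (W, Y) (conj (ltW Wr) BY); rewrite /g /f /S /=; lra.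
have vP : 0 <= F Y P.
  apply: vsup => //; rewrite /P mulrC -scalerA -scalerN -scalerN opprB.
  apply: superjet_sub (superjetZ ci (superjet_sq setT Z Y)) _.
  apply: filterS (near_norm_lt Yr) => W Wr _.
  have := ZYmax (Z, W) (conj BZ (ltW Wr)); rewrite /g /f /S /=.
  rewrite -(opprB W Z) -(opprB Y Z) !(pdNl, pdNr) !opprK; lra.
have /= := FL Y Z P BY BZ.
have YZd : `|Y - Z| < d.
  rewrite -(subrKA Z1) (le_lt_trans (ler_normD _ _)) // (distrC Z1); lra.
have := dP _ (normr_ge0 _) YZd.
have : L * `|Y - Z| * `|P| <= L * (2 * e).
  rewrite -mulrA ler_wpM2l // /P normrZ (distrC Y) (ger0_norm (mulr_ge0 _ ci)) //.
  rewrite mulrCA -expr2 -mulrA ler_wpM2l //.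
  have : c^-1 * `|Z - Y| ^+ 2 <= c^-1 * S (Z, Y) by rewrite ler_wpM2l // norm_sqr_le_pd.
  by move: fe g0; rewrite (mulrC (S _)); lra.
lra.
Qed.

End Interior.

(** * Doubling of variables at the interface *)

(* [kink a] is [C^{1,1}], uniformly close to the identity as [a] tends to [0], and
   flat at the origin. *)
Section Kink.
Context {R : realType}.
Implicit Types a z y : R.

Definition kink a z : R := z * `|z| / (`|z| + a).
Definition kink' a z : R := 1 - a ^+ 2 / (`|z| + a) ^+ 2.

Lemma kinkN a z : kink a (- z) = - kink a z.
Proof. by rewrite /kink normrN !mulNr. Qed.

Lemma kink'N a z : kink' a (- z) = kink' a z.
Proof. by rewrite /kink' normrN. Qed.

Lemma kink0 a : kink a 0 = 0.
Proof. by rewrite /kink !mul0r. Qed.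

Lemma kink'0 a : 0 < a -> kink' a 0 = 0.
Proof. by move=> a0; rewrite /kink' normr0 add0r divff ?subrr // expf_neq0 ?gt_eqF. Qed.

Lemma kink'_bounds a z : 0 < a -> 0 <= kink' a z <= 1.
Proof.
move=> a0; have := normr_ge0 z; rewrite /kink'; set t := `|z| => t0.
have ta : 0 < (t + a) ^+ 2 by rewrite exprn_gt0 //; lra.
rewrite subr_ge0 ler_pdivrMr // mul1r lerBlDr lerDl divr_ge0 ?sqr_ge0 // andbT.
by rewrite ler_pXn2r ?nnegrE //; lra.
Qed.

Lemma kink_ge0 a z : 0 < a -> 0 <= z -> 0 <= kink a z.
Proof. by move=> a0 z0; rewrite /kink divr_ge0 ?mulr_ge0 ?addr_ge0 // ltW. Qed.

Lemma kink_dist a z : 0 < a -> `|kink a z - z| <= a.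
Proof.
move=> a0; have := normr_ge0 z => t0; have ta : 0 < `|z| + a by lra.
have -> : kink a z - z = - (z * a / (`|z| + a)) by rewrite /kink; field; lra.
rewrite normrN normrM normrM normfV (gtr0_norm ta) (gtr0_norm a0).
by rewrite ler_pdivrMr //; nra.
Qed.

(** Near 0, [kink a z] behaves like [z |z| / a] and its derivative like [2 |z| / a]. The relation
    between the two, free of [z], converts a bound on [kink] into one on its slope. *)
Lemma kink'_sqr a z : 0 < a -> kink' a z ^+ 2 <= 4 * `|kink a z| / a.
Proof.
move=> a0; rewrite /kink' /kink; have := normr_ge0 z => t0.
have ta : 0 < `|z| + a by lra.
rewrite !normrM normfV normr_id (gtr0_norm ta).
set t := `|z| in t0 ta *; rewrite ler_pdivlMr //.
have -> : 1 - a ^+ 2 / (t + a) ^+ 2 = t * (t + 2 * a) / (t + a) ^+ 2.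
  by field; lra.
have -> : 4 * (t * t / (t + a)) = 4 * t ^+ 2 * (t + a) ^+ 3 / (t + a) ^+ 4.
  by field; lra.
have -> : (t * (t + 2 * a) / (t + a) ^+ 2) ^+ 2 * a
    = t ^+ 2 * ((t + 2 * a) ^+ 2 * a) / (t + a) ^+ 4 by field; lra.
rewrite ler_pM2r ?invr_gt0 ?exprn_gt0 //.
have -> : 4 * t ^+ 2 * (t + a) ^+ 3 = t ^+ 2 * (4 * (t + a) ^+ 3) by ring.
rewrite ler_wpM2l ?sqr_ge0 // -subr_ge0.
have -> : 4 * (t + a) ^+ 3 - (t + 2 * a) ^+ 2 * a =
    4 * t ^+ 3 + 11 * (t ^+ 2 * a) + 8 * (t * a ^+ 2) by ring.
by rewrite !addr_ge0 ?mulr_ge0 ?exprn_ge0 // ltW.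
Qed.

Lemma kink_quad a z y : 0 < a ->
  `|kink a y - kink a z - kink' a z * (y - z)| <= 3 / a * (y - z) ^+ 2.
Proof.
move=> a0; wlog z0 : y z / 0 <= z.
  move=> H; have [/H //|z0] := leP 0 z.
  have := H (- y) (- z); rewrite oppr_ge0 ltW // !kinkN kink'N => /(_ isT).
  rewrite -normrN (_ : - (_ - _ - _) = kink a y - kink a z - kink' a z * (y - z)); last by ring.
  by rewrite (_ : (- y - - z) ^+ 2 = (y - z) ^+ 2) //; ring.
rewrite /kink /kink' (ger0_norm z0).
have za : 0 < z + a by lra.
have [y0|y0] := leP 0 y.
  have ya : 0 < y + a by lra.
  rewrite (ger0_norm y0).
  have -> : y * y / (y + a) - z * z / (z + a) - (1 - a ^+ 2 / (z + a) ^+ 2) * (y - z)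
     = a ^+ 2 / ((y + a) * (z + a) ^+ 2) * (y - z) ^+ 2.
    by field; rewrite !lt0r_neq0.
  rewrite normrM (ger0_norm (sqr_ge0 (y - z))) ler_wpM2r ?sqr_ge0 //.
  rewrite ger0_norm; last by rewrite divr_ge0 ?sqr_ge0 // mulr_ge0 ?sqr_ge0 ?ltW.
  rewrite ler_pdivrMr; last by rewrite mulr_gt0 ?exprn_gt0.
  rewrite mulrAC ler_pdivlMr //.
  have : a * a ^+ 2 <= (y + a) * (z + a) ^+ 2.
    apply: ler_pM; rewrite ?sqr_ge0 //; [lra|lra|rewrite ler_pXn2r ?nnegrE //; lra].
  have : 0 <= a * a ^+ 2 by rewrite mulr_ge0 ?sqr_ge0 ?ltW.
  move: (_ * (z + a) ^+ 2) => w; lra.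
rewrite (ltr0_norm y0).
have ya : 0 < - y + a by lra.
set q := 1 - _; have qE : q = z * (z + 2 * a) / (z + a) ^+ 2 by rewrite /q; field; lra.
have q0 : 0 <= q by rewrite qE divr_ge0 ?sqr_ge0 // mulr_ge0 //; lra.
have qz : q <= 2 * z / a.
  rewrite qE ler_pdivrMr ?exprn_gt0 // mulrAC ler_pdivlMr // -subr_ge0.
  have -> : 2 * z * (z + a) ^+ 2 - z * (z + 2 * a) * a = 2 * z ^+ 3 + 3 * (z ^+ 2 * a).
    by ring.
  by rewrite addr_ge0 ?mulr_ge0 ?exprn_ge0 // ltW.
have h1 : 0 <= y * - y / (- y + a) + y ^+ 2 / a.
  have -> : y * - y / (- y + a) + y ^+ 2 / a = y ^+ 2 * (- y) / (a * (- y + a)).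
    by field; rewrite !lt0r_neq0.
  apply: divr_ge0; apply: mulr_ge0; rewrite ?sqr_ge0 //; lra.
have h2 : y * - y / (- y + a) <= 0.
  by rewrite pmulr_lle0 ?invr_gt0 // mulrN oppr_le0 -expr2 sqr_ge0.
have h3 : 0 <= z * z / (z + a) by rewrite divr_ge0 ?mulr_ge0 // ltW.
have h4 : z * z / (z + a) <= z ^+ 2 / a.
  by rewrite -expr2 ler_wpM2l ?sqr_ge0 // lef_pV2 ?posrE // lerDr.
have h5 : 0 <= q * (z - y).
  by rewrite mulr_ge0 //; lra.
have h6 : q * (z - y) <= 2 * z / a * (z - y) by rewrite ler_wpM2r //; lra.
have h7 : y ^+ 2 / a + z ^+ 2 / a + 2 * z / a * (z - y) <= 3 / a * (y - z) ^+ 2.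
  have -> : y ^+ 2 / a + z ^+ 2 / a + 2 * z / a * (z - y) =
     (y ^+ 2 + z ^+ 2 + 2 * z * (z - y)) / a by field; lra.
  rewrite -[leRHS]mulrAC ler_wpM2r ?invr_ge0 ?ltW //.
  have : 0 <= z * - y by rewrite mulr_ge0 //; lra.
  by nra.
by rewrite ler_norml; apply/andP; split; lra.
Qed.

Lemma continuous_quad_approx (k k' : R -> R) (C : R) :
  (forall z, 0 <= k' z <= 1) ->
  (forall z y, `|k y - k z - k' z * (y - z)| <= C * (y - z) ^+ 2) ->
  forall z, \forall y \near z, `|k y - k z| <= (1 + `|C|) * `|y - z|.
Proof.
move=> k'1 kC z; have z1 : `|z - z| < 1 by rewrite subrr normr0.
apply: filterS (near_norm_lt z1) => y yz.
have := kC z y; have /andP[k0 k1] := k'1 z => H.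
rewrite -(subrK (k' z * (y - z)) (k y - k z)); apply: le_trans (ler_normD _ _) _.
have : `|k' z * (y - z)| <= `|y - z| by rewrite normrM ler_piMl // ger0_norm.
have : C * (y - z) ^+ 2 <= `|C| * `|y - z|.
  apply: le_trans (ler_norm _) _; rewrite normrM normrX ler_wpM2l //.
  by rewrite expr2 ler_piMl // ltW.
lra.
Qed.

Lemma quad_approx_continuous (k k' : R -> R) (C : R) :
  (forall z, 0 <= k' z <= 1) ->
  (forall z y, `|k y - k z - k' z * (y - z)| <= C * (y - z) ^+ 2) ->
  continuous k.
Proof.
move=> k'1 kC z; apply/cvgrPdist_le => e e0.
have C0 : 0 < 1 + `|C| by have := normr_ge0 C; lra.
have ze : `|z - z| < e / (1 + `|C|) by rewrite subrr normr0 divr_gt0.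
apply: filterS2 (continuous_quad_approx k'1 kC z) (near_norm_lt ze) => y H1 H2.
rewrite distrC; apply: le_trans H1 _; rewrite mulrC -ler_pdivlMr //; exact: ltW.
Qed.

End Kink.

Lemma spacetime_ext {R : realType} {m : nat} (Z Y : 'rV[R]_m * R) :
  (forall i, Z.1 0 i = Y.1 0 i) -> Z.2 = Y.2 -> Z = Y.
Proof. by case: Z Y => [x t] [y s] /= /rowP -> ->. Qed.

Lemma scale_regular {R : realType} (a b : R) : a *: (b : R^o) = a * b.
Proof. by []. Qed.

Ltac spacetime_ring :=
  apply: spacetime_ext => [?|] /=; rewrite ?mxE ?scale_regular; ring.

Section Doubling.
Context {R : realType} {m : nat}.
Local Notation X := ('rV[R]_m * R)%type.
Variable E : X.
Hypothesis E1 : pd E E = 1.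
Implicit Types Z Y W P : X.

(** [E] will be [(eN, 0)], so the time is kept among the tangential components. *)
Definition tangential Z : X := Z - pd Z E *: E.
Definition tsq Z : R := pd Z Z - pd Z E ^+ 2.

Lemma tangential_normal Z : pd (tangential Z) E = 0.
Proof. by rewrite /tangential !pdE E1; ring. Qed.

Lemma tangentialB Z Y : tangential (Z - Y) = tangential Z - tangential Y.
Proof. by rewrite /tangential !pdE; spacetime_ring. Qed.

Lemma tangentialN Z : tangential (- Z) = - tangential Z.
Proof. by rewrite /tangential !pdE; spacetime_ring. Qed.

Lemma tangential_id Z : pd Z E = 0 -> tangential Z = Z.
Proof. by move=> Z0; rewrite /tangential Z0 scale0r subr0. Qed.

Lemma tsqE Z : tsq Z = pd (tangential Z) (tangential Z).
Proof. by rewrite /tsq /tangential !pdE E1 (pdC E Z); ring. Qed.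

Lemma tsqN Z : tsq (- Z) = tsq Z.
Proof. by rewrite /tsq !pdE opprK sqrrN. Qed.

Lemma tsq_ge0 Z : 0 <= tsq Z.
Proof. by rewrite tsqE pd_ge0. Qed.

Lemma unit_norm_le1 : `|E| <= 1.
Proof.
have := norm_sqr_le_pd E; rewrite E1 => H.
by rewrite -(@ler_pXn2r _ 2) ?nnegrE // expr1n.
Qed.

Lemma pd_unit_le_norm Z : `|pd Z E| <= m.+1%:R * `|Z|.
Proof.
by apply: le_trans (pd_le_norm _ _) _; rewrite ler_piMr ?unit_norm_le1.
Qed.

Lemma tangential_le_norm Z : `|tangential Z| <= m.+2%:R * `|Z|.
Proof.
apply: le_trans (ler_normB _ _) _; rewrite normrZ -(natr1 m.+1) mulrDl mul1r addrC.
rewrite lerD2r; apply: le_trans (pd_unit_le_norm _).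
by rewrite ler_piMr // unit_norm_le1.
Qed.

Lemma superjet_tsq D A Z : superjet D (fun W => tsq (W - A)) Z (2 *: tangential (Z - A)).
Proof.
have H := superjetD (superjet_sq D A Z) (superjet_lin_sq D E (pd A E) (-1) Z).
have <- : 2 *: (Z - A) + (2 * -1 * (pd Z E - pd A E)) *: E = 2 *: tangential (Z - A).
  by rewrite /tangential !pdE; spacetime_ring.
rewrite (_ : (fun W => _) = (fun W => pd (W - A) (W - A)) \+
  (fun W => -1 * (pd W E - pd A E) ^+ 2)) //.
by apply/funext => W; rewrite /= /tsq !pdE; ring.
Qed.

Lemma continuous_sqr {T : topologicalType} (f : T -> R) :
  continuous f -> continuous (fun x => f x ^+ 2).
Proof. by move=> fc x; apply: cvgM; exact: fc. Qed.

Lemma continuous_pd_unit : continuous (fun W => pd W E).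
Proof.
apply: continuous_pd; [by move=> W; exact: cvg_id | by move=> W; exact: cvg_cst].
Qed.

Context (u v : X -> R) (Z1 : X) (r : R).
Hypothesis r0 : 0 < r.
Let B := cball Z1 r.
Let K := B `*` B.
Hypothesis uu : usc_within B u.
Hypothesis vu : usc_within B (fun Z => - v Z).

Lemma usc_doubling : usc_within K (fun p : X * X => u p.1 - v p.2).
Proof.
apply: (@usc_withinD _ _ _ (u \o fst) ((fun Z => - v Z) \o snd)).
  have Kfst (p : X * X) (Kp : K p) : B p.1 := proj1 Kp.
  exact: usc_within_comp uu (@continuous_fst X X) Kfst.
have Ksnd (p : X * X) (Kp : K p) : B p.2 := proj2 Kp.
exact: usc_within_comp vu (@continuous_snd X X) Ksnd.
Qed.

Lemma continuous_sub_pair : continuous (fun p : X * X => p.1 - p.2).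
Proof. by move=> p; apply: cvgB; [exact: cvg_fst | exact: cvg_snd]. Qed.

Lemma continuous_tsq_pair : continuous (fun p : X * X => tsq (p.1 - p.2)).
Proof.
move=> p; have c := continuous_sub_pair; apply: cvgB.
  exact: (continuous_pd c c).
exact: continuous_sqr (continuous_pd c (fun=> cvg_cst _)) p.
Qed.

Lemma near_pair Z Y (W W' : X) (s : R) : `|Z - W| < s -> `|Y - W'| < s ->
  nbhs (Z, Y) (fun p : X * X => `|p.1 - W| < s /\ `|p.2 - W'| < s).
Proof.
move=> ZW YW.
have H1 : nbhs (Z, Y) (fun p : X * X => `|p.1 - W| < s).
  exact: (@continuous_fst X X (Z, Y) _ (near_norm_lt ZW)).
have H2 : nbhs (Z, Y) (fun p : X * X => `|p.2 - W'| < s).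
  exact: (@continuous_snd X X (Z, Y) _ (near_norm_lt YW)).
exact: filterI H1 H2.
Qed.

(** On the closed set of pairs with equal normal coordinates, [tsq (Z - Y) = 0] forces [Z = Y], so
    the strict maximum of [u - v] at [Z1] attracts both points. The bound on [|Zb - Yb| ^+ 2 / c]
    makes the product of the distance and of the jet [2 (Zb - Yb) / c] small. *)
Lemma tangential_doubling (e : R) : 0 < e -> e <= r ->
  (forall Z, B Z -> u Z1 - v Z1 <= u Z - v Z -> Z = Z1) ->
  exists (c : R) (Zb Yb : X), [/\ 0 < c, `|Zb - Z1| < e, `|Yb - Z1| < e,
    pd Zb E = pd Yb E & `|Zb - Yb| ^+ 2 / c <= e] /\
    forall Z Y, B Z -> B Y -> pd Z E = pd Y E ->
      u Z - v Y - tsq (Z - Y) / c <= u Zb - v Yb - tsq (Zb - Yb) / c.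
Proof.
move=> e0 er uvmax.
pose f (p : X * X) := u p.1 - v p.2.
pose S (p : X * X) := tsq (p.1 - p.2).
pose K' := K `&` [set p : X * X | pd (p.1 - p.2) E = 0].
have BZ1 : B Z1 by rewrite /B /cball /= subrr normr0 ltW.
have KZ1 : K' (Z1, Z1) by split; [exact: (conj BZ1 BZ1) | rewrite /= subrr pd0l].
have Kc : compact K' .
  apply: compact_closedI; first by apply: compact_setX; exact: cball_compact.
  apply: (@closed_comp _ _ (fun p : X * X => pd (p.1 - p.2) E) [set 0]).
    by move=> p _; exact: (continuous_pd continuous_sub_pair (fun=> cvg_cst _)).
  exact: closed_eq.
have KK' : K' `<=` K by move=> p [].
have fu : usc_within K' f := usc_withinW KK' usc_doubling.
have Sc : continuous S := continuous_tsq_pair.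
have S0 p : 0 <= S p by exact: tsq_ge0.
have Smax p : K' p -> S p = 0 -> f (Z1, Z1) <= f p -> p = (Z1, Z1).
  case: p => Z Y [[/= BZ BY]] H; rewrite /S /tsq H expr0n subr0 /=.
  move=> /pd_eq0/eqP; rewrite subr_eq0 => /eqP /= ZY.
  by rewrite -{}ZY /f /= => /(uvmax _ BZ) ->.
pose U := [set p : X * X | (K' p -> f p < f (Z1, Z1) + e) /\
  (`|p.1 - Z1| < e /\ `|p.2 - Z1| < e)].
have Z1e : `|Z1 - Z1| < e by rewrite subrr normr0.
have UZ : nbhs (Z1, Z1) U.
  have h1 : nbhs (Z1, Z1) (fun p => K' p -> f p < f (Z1, Z1) + e) := fu _ KZ1 e e0.
  exact: filterI h1 (near_pair Z1e Z1e).
have [c c0 cP] := penalization Kc fu Sc S0 Smax UZ.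
pose g p := f p - c^-1 * S p.
have gu : usc_within K' g.
  apply: usc_withinD fu _; apply: usc_within_continuous => p.
  by apply: cvgN; apply: cvgMr; exact: Sc.
have [[Z Y] KZY ZYmax] := usc_compact_max Kc (ex_intro _ (Z1, Z1) KZ1) gu.
have S1 : S (Z1, Z1) = 0 by rewrite /S /tsq /= subrr !pd0l expr0n subr0.
have g0 : f (Z1, Z1) <= f (Z, Y) - S (Z, Y) / c.
  by have := ZYmax (Z1, Z1) KZ1; rewrite /g S1 mulr0 subr0 (mulrC c^-1).
have UZY : U (Z, Y) by apply: (cP c) => //; lra.
have [BZY] := KZY; rewrite /= !pdE => ZYE.
move: UZY => [/(_ KZY) fe [/= Zr Yr]].
have ZYE' : pd Z E = pd Y E by lra.
exists c, Z, Y; split; last first.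
  move=> Z' Y' BZ' BY' ZYE2; have KZY' : K' (Z', Y').
    by split; [exact: (conj BZ' BY') | rewrite /= !pdE; lra].
  by have := ZYmax (Z', Y') KZY'; rewrite /g /f /S /= !(mulrC c^-1).
split => //.
have : `|Z - Y| ^+ 2 / c <= S (Z, Y) / c.
  have tZY : pd (Z - Y) E = 0 by rewrite !pdE; lra.
  rewrite ler_wpM2r // ?invr_ge0; first exact: ltW.
  by rewrite /S tsqE /= tangential_id // norm_sqr_le_pd.
by move: fe g0; lra.
Qed.

(* [k] bends the penalization of the normal coordinate; [theta] is its
   derivative, so that the slope seen by [v] is [theta] times that seen by [u]. *)
Lemma normal_doubling (c : R) Zb Yb (s w : R) : 0 < c -> 0 < w ->
  `|Zb - Z1| < r -> `|Yb - Z1| < r -> pd Zb E = pd Yb E ->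
  (forall Z Y, B Z -> B Y -> pd Z E = pd Y E ->
     u Z - v Y - tsq (Z - Y) / c <= u Zb - v Yb - tsq (Zb - Yb) / c) ->
  let p := (2 / c) *: tangential (Zb - Yb) in
  exists2 e0 : R, 0 < e0 & forall (kappa a C : R) (k theta : R -> R),
    0 < kappa -> kappa <= e0 -> a ^+ 2 <= kappa * e0 ->
    (forall z, `|k z - z| <= a) ->
    (forall z, 0 <= theta z <= 1) ->
    (forall z y, `|k y - k z - theta z * (y - z)| <= C * (y - z) ^+ 2) ->
    k (pd Yb E) = pd Yb E ->
    exists Z Y eZ eY : X, let g := 2 / kappa * (pd Z E - k (pd Y E)) in
      [/\ `|Z - Zb| < w, `|Y - Yb| < w, `|eZ| <= w & `|eY| <= w] /\
      [/\ `|Z - Z1| < r, `|Y - Z1| < r,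
        superjet setT u Z (p + (s + g) *: E + eZ) &
        superjet setT (fun W => - v W) Y (- (p + (s + theta (pd Y E) * g) *: E + eY))].
Proof.
move=> c0 w0 Zr Yr ZYE ZYmax p.
(* The two squares make [(Zb, Yb)] the only maximum point among pairs with equal normal coordinates,
   so that penalization localizes there; the linear term centres the normal slopes at [s]. *)
pose f (q : X * X) := u q.1 - v q.2 - tsq (q.1 - q.2) / c - s * pd (q.1 - q.2) E
  - pd (q.1 - Zb) (q.1 - Zb) - pd (q.2 - Yb) (q.2 - Yb).
pose S (q : X * X) := pd (q.1 - q.2) E ^+ 2.
have Kc : compact K by apply: compact_setX; exact: cball_compact.
have pdc (g h : X * X -> X) : continuous g -> continuous h ->
    continuous (fun q => pd (g q) (h q)) by exact: continuous_pd.
have dc := continuous_sub_pair.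
have Ec : continuous (fun q : X * X => pd (q.1 - q.2) E) by apply: pdc => // q; exact: cvg_cst.
have fu : usc_within K f.
  have c1 : continuous (fun q : X * X => - (tsq (q.1 - q.2) / c)).
    by move=> q; apply: cvgN; apply: cvgMl; exact: continuous_tsq_pair.
  have c2 : continuous (fun q : X * X => - (s * pd (q.1 - q.2) E)).
    by move=> q; apply: cvgN; apply: cvgMr; exact: Ec.
  have c3 : continuous (fun q : X * X => - pd (q.1 - Zb) (q.1 - Zb)).
    have h : continuous (fun q : X * X => q.1 - Zb).
      by move=> q; apply: cvgB; [exact: cvg_fst | exact: cvg_cst].
    by move=> q; apply: cvgN; exact: pdc.
  have c4 : continuous (fun q : X * X => - pd (q.2 - Yb) (q.2 - Yb)).
    have h : continuous (fun q : X * X => q.2 - Yb).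
      by move=> q; apply: cvgB; [exact: cvg_snd | exact: cvg_cst].
    by move=> q; apply: cvgN; exact: pdc.
  have f1 := usc_withinD usc_doubling (usc_within_continuous (K := K) c1).
  have f2 := usc_withinD f1 (usc_within_continuous (K := K) c2).
  have f3 := usc_withinD f2 (usc_within_continuous (K := K) c3).
  exact: usc_withinD f3 (usc_within_continuous (K := K) c4).
have Sc : continuous S.
  exact: continuous_sqr Ec.
have S0 q : 0 <= S q by exact: sqr_ge0.
have BZb : B Zb := ltW Zr.
have BYb : B Yb := ltW Yr.
have fb : f (Zb, Yb) = u Zb - v Yb - tsq (Zb - Yb) / c.
  by rewrite /f /= !subrr !pd0l !pdE ZYE subrr mulr0 !subr0.
have Smax q : K q -> S q = 0 -> f (Zb, Yb) <= f q -> q = (Zb, Yb).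
  case: q => Z Y [BZ BY] /eqP; rewrite sqrf_eq0 !pdE /= => /eqP H.
  have ZYE' : pd Z E = pd Y E by lra.
  have := ZYmax Z Y BZ BY ZYE'; rewrite fb /f /= !pdE ZYE' subrr mulr0 => H1 H2.
  have hZ := pd_ge0 (Z - Zb); have hY := pd_ge0 (Y - Yb).
  have /pd_eq0/eqP : pd (Z - Zb) (Z - Zb) = 0 by move: H2 hZ hY; rewrite !pdE; lra.
  have /pd_eq0/eqP : pd (Y - Yb) (Y - Yb) = 0 by move: H2 hZ hY; rewrite !pdE; lra.
  by rewrite !subr_eq0 => /eqP -> /eqP ->.
(* [A] measures the jet errors in units of [w']: the first summand bounds the variation of the
   tangential jet, the 2 the gradient of a localizing square. *)
pose A : R := (m.+2%:R * 2) * (2 / c) + 2.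
have A2 : 2 <= A by rewrite /A lerDr !mulr_ge0 // invr_ge0 ltW.
pose w' := w / A.
have w'0 : 0 < w' by rewrite divr_gt0 //; lra.
have w'w : A * w' <= w by rewrite /w' mulrC divfK //; lra.
pose d := Num.min w' (Num.min (r - `|Zb - Z1|) (r - `|Yb - Z1|)).
have d0 : 0 < d by rewrite !lt_min w'0 !subr_gt0 Zr Yr.
have UZ := near_pair (ltac:(by rewrite subrr normr0) : `|Zb - Zb| < d)
  (ltac:(by rewrite subrr normr0) : `|Yb - Yb| < d).
have [e0 e00 eP] := penalization Kc fu Sc S0 Smax UZ.
(* Concentration is known for the penalty [(x_N - y_N)^2 / e0]. Passing to [x_N - k(y_N)] costs a
   factor 2 and an error [a^2 / kappa], hence the half. *)
exists (e0 / 2); first by rewrite divr_gt0.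
move=> kappa a C k theta k0 ke ae ka th1 kC kb.
have kc := quad_approx_continuous th1 kC.
pose g (q : X * X) := f q - kappa^-1 * (pd q.1 E - k (pd q.2 E)) ^+ 2.
have gu : usc_within K g.
  apply: usc_withinD fu _; apply: usc_within_continuous => q.
  apply: cvgN; apply: cvgMr; move: q; apply: continuous_sqr => q.
  have h1 : continuous (fun q : X * X => pd q.1 E).
    by apply: pdc => x; [exact: cvg_fst | exact: cvg_cst].
  have h2 : continuous (fun q : X * X => pd q.2 E).
    by apply: pdc => x; [exact: cvg_snd | exact: cvg_cst].
  apply: cvgB; first exact: h1.
  by apply: (@continuous_comp _ _ _ (fun q : X * X => pd q.2 E) k); [exact: h2 | exact: kc].
have KZYb : K (Zb, Yb) := conj BZb BYb.
have [[Z Y] KZY gmax] := usc_compact_max Kc (ex_intro _ (Zb, Yb) KZYb) gu.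
have gb : f (Zb, Yb) <= g (Z, Y).
  by have := gmax (Zb, Yb) KZYb; rewrite {1}/g /= kb ZYE subrr expr0n mulr0 subr0.
have [/= Zd Yd] : `|(Z, Y).1 - Zb| < d /\ `|(Z, Y).2 - Yb| < d.
  apply: (eP e0) => //; apply: (@le_trans _ _ (g (Z, Y) - e0)); first by lra.
  rewrite /g /S /= !pdE.
  have := ka (pd Y E); set y := pd Y E; set z := pd Z E => kay.
  have a0 : 0 <= a by apply: le_trans kay; exact: normr_ge0.
  have h1 : (z - y) ^+ 2 <= 2 * (z - k y) ^+ 2 + 2 * a ^+ 2.
    have : (k y - y) ^+ 2 <= a ^+ 2.
      by rewrite -(real_normK (num_real (k y - y))) ler_pXn2r ?nnegrE.
    have : 0 <= ((z - k y) - (k y - y)) ^+ 2 by exact: sqr_ge0.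
    have -> : (z - y) ^+ 2 = ((z - k y) + (k y - y)) ^+ 2 by ring.
    nra.
  have h2 : (z - y) ^+ 2 / e0 <= kappa^-1 / 2 * (z - y) ^+ 2.
    rewrite mulrC ler_wpM2r ?sqr_ge0 // -invfM lef_pV2 ?posrE //; last by rewrite mulr_gt0.
    by lra.
  have h3 : kappa^-1 / 2 * (z - y) ^+ 2 <= kappa^-1 / 2 * (2 * (z - k y) ^+ 2 + 2 * a ^+ 2).
    by rewrite ler_wpM2l // divr_ge0 ?invr_ge0 ?ltW.
  have h4 : kappa^-1 * a ^+ 2 <= e0 / 2 by rewrite mulrC ler_pdivrMr // mulrC.
  have h5 : kappa^-1 / 2 * (2 * (z - k y) ^+ 2 + 2 * a ^+ 2) =
    kappa^-1 * (z - k y) ^+ 2 + kappa^-1 * a ^+ 2 by field; rewrite lt0r_neq0.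
  lra.
have Zw : `|Z - Zb| < w' by move: Zd; rewrite lt_min => /andP[].
have Yw : `|Y - Yb| < w' by move: Yd; rewrite lt_min => /andP[].
have Zr' : `|Z - Z1| < r.
  rewrite -(subrKA Zb) (le_lt_trans (ler_normD _ _)) //.
  by move: Zd; rewrite !lt_min => /and3P[_ ? _]; lra.
have Yr' : `|Y - Z1| < r.
  rewrite -(subrKA Yb) (le_lt_trans (ler_normD _ _)) //.
  by move: Yd; rewrite !lt_min => /and3P[_ _ ?]; lra.
have ci : 0 <= c^-1 by rewrite invr_ge0 ltW.
have c2 : 0 <= 2 / c by rewrite divr_ge0 // ltW.
have ww' : w' <= w by apply: le_trans w'w; rewrite ler_peMl ?ltW //; lra.
pose D0 := (2 / c) *: tangential (Z - Y - (Zb - Yb)).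
have D0w : `|D0| <= (m.+2%:R * 2) * (2 / c) * w'.
  rewrite normrZ ger0_norm // mulrC mulrAC ler_wpM2r //.
  apply: le_trans (tangential_le_norm _) _; rewrite -mulrA ler_wpM2l //.
  have -> : Z - Y - (Zb - Yb) = (Z - Zb) - (Y - Yb).
    by spacetime_ring.
  by apply: le_trans (ler_normB _ _) _; lra.
have tZY : (2 / c) *: tangential (Z - Y) = p + D0.
  by rewrite /p /D0 (tangentialB (Z - Y)); spacetime_ring.
exists Z, Y, (D0 + 2 *: (Z - Zb)), (D0 - 2 *: (Y - Yb)) => /=.
have A2w : `|D0| + 2 * w' <= w.
  by apply: le_trans w'w; rewrite /A [leRHS]mulrDl lerD2r.
split.
  split; [exact: lt_le_trans Zw ww' | exact: lt_le_trans Yw ww' | |].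
    apply: le_trans (ler_normD _ _) _; apply: le_trans A2w.
    by rewrite lerD2l normrZ ger0_norm // ler_wpM2l // ltW.
  apply: le_trans (ler_normB _ _) _; apply: le_trans A2w.
  by rewrite lerD2l normrZ ger0_norm // ler_wpM2l // ltW.
split => //.
- have j1 := superjetZ ci (superjet_tsq setT Y Z).
  have j2 := superjetD j1 (superjet_lin setT (s *: E) Z).
  have j3 := superjetD j2 (superjet_sq setT Zb Z).
  have j4 := superjetD j3 (superjet_lin_sq setT E (k (pd Y E)) kappa^-1 Z).
  set P := _ + (2 * _ * _) *: E in j4.
  have PE : P = p + (s + 2 / kappa * (pd Z E - k (pd Y E))) *: E + (D0 + 2 *: (Z - Zb)).
    by rewrite /P scalerA (mulrC c^-1) tZY; spacetime_ring.
  rewrite -PE; apply: superjet_sub j4 _; apply: filterS (near_norm_lt Zr') => W Wr _.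
  have := gmax (W, Y) (conj (ltW Wr) KZY.2).
  by rewrite /g /f /= !pdE; lra.
(* The expansion of the bent penalty in [y_N] uses only the quadratic approximation of [k], which
   need not be twice differentiable. After division by [kappa] its slope is [- theta g]. *)
- have [C' kq] : exists C', \forall y \near pd Y E,
    (pd Z E - k y) ^+ 2 <= (pd Z E - k (pd Y E)) ^+ 2
      - 2 * theta (pd Y E) * (pd Z E - k (pd Y E)) * (y - pd Y E) + C' * (y - pd Y E) ^+ 2.
    exists (2 * `|pd Z E - k (pd Y E)| * C + (1 + `|C|) ^+ 2).
    apply: filterS (continuous_quad_approx th1 kC (pd Y E)) => y.
    have := kC (pd Y E) y; set y0 := pd Y E; set b := pd Z E - k y0 => H1 H2.
    have h1 : (k y - k y0) ^+ 2 <= (1 + `|C|) ^+ 2 * (y - y0) ^+ 2.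
      rewrite -(real_normK (num_real (k y - k y0))) -(real_normK (num_real (y - y0))) -exprMn.
      by rewrite ler_pXn2r ?nnegrE // mulr_ge0 ?addr_ge0.
    have h2 : - (b * (k y - k y0 - theta y0 * (y - y0))) <= `|b| * (C * (y - y0) ^+ 2).
      by apply: le_trans (ler_norm _) _; rewrite normrN normrM ler_wpM2l.
    have -> : pd Z E - k y = b - (k y - k y0) by rewrite /b; ring.
    by nra.
  have j0 : superjet setT (fun W => kappa^-1 * (pd Z E - k (pd W E)) ^+ 2) Y
     (- (theta (pd Y E) * (2 / kappa * (pd Z E - k (pd Y E)))) *: E).
    exists (kappa^-1 * `|C'| * m.+1%:R ^+ 2).
    have kqW : nbhs Y ((fun W => pd W E) @^-1` _) := continuous_pd_unit kq.
    apply: filterS kqW => W /= H _.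
    have ki : 0 <= kappa^-1 by rewrite invr_ge0 ltW.
    have h1 : kappa^-1 * (C' * pd (W - Y) E ^+ 2) <= kappa^-1 * `|C'| * m.+1%:R ^+ 2 * pd (W - Y) (W - Y).
      rewrite -!mulrA ler_wpM2l //.
      apply: (@le_trans _ _ (`|C'| * pd (W - Y) E ^+ 2)); first by rewrite ler_wpM2r ?sqr_ge0 ?ler_norm.
      rewrite ler_wpM2l //.
      apply: (@le_trans _ _ ((m.+1%:R * `|W - Y|) ^+ 2)).
        by rewrite -(real_normK (num_real (pd _ _))) ler_pXn2r ?nnegrE ?mulr_ge0 // pd_unit_le_norm.
      by rewrite exprMn [leRHS]mulrA -expr2 ler_wpM2l ?sqr_ge0 // norm_sqr_le_pd.
    have /(ler_wpM2l ki) := H.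
    have -> : pd W E - pd Y E = pd (W - Y) E by rewrite !pdE.
    rewrite pdZl (pdC E); move: h1; set S1 := pd (W - Y) E; set S2 := pd (W - Y) (W - Y).
    set b := pd Z E - k (pd Y E); lra.
  have j1 := superjetZ ci (superjet_tsq setT Z Y).
  have j2 := superjetD j1 (superjet_lin setT (- (s *: E)) Y).
  have j3 := superjetD j2 (superjet_sq setT Yb Y).
  have j4 := superjetD j3 j0.
  set P := _ + - _ *: E in j4.
  have PE : P = - (p + (s + theta (pd Y E) * (2 / kappa * (pd Z E - k (pd Y E)))) *: E
     + (D0 - 2 *: (Y - Yb))).
    by rewrite /P scalerA (mulrC c^-1) -(opprB Z Y) tangentialN scalerN tZY; spacetime_ring.
  rewrite -PE; apply: superjet_sub j4 _; apply: filterS (near_norm_lt Yr') => W Wr _.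
  have := gmax (Z, W) (conj KZY.1 (ltW Wr)).
  rewrite /g /f /= -(tsqN (W - Z)) -(tsqN (Y - Z)) !opprB !pdE; lra.
Qed.

End Doubling.

(** * The contradiction when the strict maximum lies on the interface *)

Section Interface.
Context {R : realType} {m : nat}.
Local Notation X := ('rV[R]_m * R)%type.
Implicit Types (Z Y P : X) (i : bool).
Variable E : X.
Hypothesis E1 : pd E E = 1.

Definition side_sign i : R := if i then 1 else -1.
Definition on_side i Z : Prop := 0 < side_sign i * pd Z E.
Definition on_closed_side i Z : Prop := 0 <= side_sign i * pd Z E.

Lemma same_side i (x y : R) :
  0 < side_sign i * x -> `|y - x| < `|x| -> 0 < side_sign i * y.
Proof.
rewrite /side_sign ltr_norml; case: i => x0.
  by rewrite gtr0_norm; lra.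
by rewrite ltr0_norm; lra.
Qed.

Lemma side_cases Z :
  (exists i, on_side i Z) \/ (pd Z E = 0 /\ forall i, on_closed_side i Z).
Proof.
rewrite /on_side /on_closed_side /side_sign.
case: (ltgtP (pd Z E) 0) => H; [left; exists false|left; exists true|right]; first by lra.
  by lra.
by split => // -[]; rewrite H mulr0.
Qed.

Lemma on_sideW i Z : on_side i Z -> on_closed_side i Z.
Proof. exact: ltW. Qed.

Context (F : bool -> X -> X -> R) (u v : X -> R) (Z1 : X).
Context (r eta L M M0 c0 : R) (mu : R -> R).
Let B := cball Z1 r.
Hypotheses (r0 : 0 < r) (eta0 : 0 < eta) (L0 : 0 <= L) (M_0 : 0 <= M)
  (M00 : 0 <= M0) (c00 : 0 < c0).
Hypothesis muP : forall e : R, 0 < e ->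
  exists2 d : R, 0 < d & forall s : R, 0 <= s -> s < d -> mu s <= e.
Hypothesis F_lip : forall i Z Y P, B Z -> B Y ->
  on_closed_side i Z -> on_closed_side i Y ->
  F i Z P <= F i Y P + L * `|Z - Y| * `|P| + mu `|Z - Y|.
Hypothesis F_lip_jet : forall i Z P P', B Z -> on_closed_side i Z ->
  F i Z P <= F i Z P' + M * `|P - P'|.
Hypothesis F_qconvex : forall i Z P P' (t c : R), B Z -> on_closed_side i Z ->
  0 <= t <= 1 -> F i Z P <= c -> F i Z P' <= c ->
  F i Z ((1 - t) *: P + t *: P') <= c.
Hypothesis F_coercive : forall i Z P (s : R), B Z -> on_closed_side i Z ->
  c0 * `|s| <= M0 * (1 + `|P|) + F i Z (P + s *: E).
Hypothesis uu : usc_within B u.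
Hypothesis vu : usc_within B (fun Z => - v Z).
Hypothesis uvmax : forall Z, B Z -> u Z1 - v Z1 <= u Z - v Z -> Z = Z1.
Hypothesis u_side : forall i Z P, `|Z - Z1| < r -> on_side i Z ->
  superjet setT u Z P -> F i Z P <= - eta.
Hypothesis u_flat : forall Z P, `|Z - Z1| < r -> pd Z E = 0 ->
  superjet setT u Z P -> exists i, F i Z P <= - eta.
Hypothesis u_tangential : forall Z P, `|Z - Z1| < r -> pd Z E = 0 -> pd P E = 0 ->
  superjet [set W | pd W E = 0] u Z P ->
  exists s : R, forall i, F i Z (P + s *: E) <= - eta.
Hypothesis v_side : forall i Z P, `|Z - Z1| < r -> on_side i Z ->
  superjet setT (fun W => - v W) Z (- P) -> 0 <= F i Z P.
Hypothesis v_flat : forall Z P, `|Z - Z1| < r -> pd Z E = 0 ->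
  superjet setT (fun W => - v W) Z (- P) -> exists i, 0 <= F i Z P.

Lemma u_some_side Z P : `|Z - Z1| < r -> superjet setT u Z P ->
  exists2 i, on_closed_side i Z & F i Z P <= - eta.
Proof.
move=> Zr uP; have [[i Zi]|[Z0 Zi]] := side_cases Z.
  by exists i; [exact: on_sideW | exact: u_side].
by have [i iP] := u_flat Zr Z0 uP; exists i.
Qed.

Let C1 := 2 * M0 / c0.

Lemma C1_ge0 : 0 <= C1.
Proof. by rewrite /C1 divr_ge0 ?mulr_ge0 // ltW. Qed.

(** Coercivity controls the normal slope linearly in the size [G] of the rest of the jet; the 2 in
    [C1] absorbs [1 + |P| <= 2 G]. *)
Lemma slope_bound i Z P (s G : R) : B Z -> on_closed_side i Z -> 1 <= G -> `|P| <= G ->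
  F i Z (P + s *: E) <= 0 -> `|s| <= C1 * G.
Proof.
move=> BZ Zi G1 PG Fs; have := F_coercive P s BZ Zi.
have : M0 * (1 + `|P|) <= M0 * (2 * G) by rewrite ler_wpM2l //; lra.
rewrite /C1 mulrAC ler_pdivlMr // => h1 h2; lra.
Qed.

Lemma scale_unit_le (s : R) : `|s *: E| <= `|s|.
Proof. by rewrite normrZ ler_piMr // unit_norm_le1. Qed.

(** The budget: [eta / 8] already spent on the perturbed jet, [eta / 8] for the modulus and
    [eta / 4] for the Lipschitz term leave half of the strictness. *)
Lemma transfer i Z Y p (s G d w : R) :
  B Z -> B Y -> on_closed_side i Z -> on_closed_side i Y -> 1 <= G ->
  `|p| <= G -> `|s| <= C1 * G -> `|Y - Z| <= d + 2 * w -> 0 <= w ->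
  mu `|Y - Z| <= eta / 8 -> L * (d + 2 * w) * ((1 + C1) * G) <= eta / 4 ->
  F i Z (p + s *: E) <= - eta + eta / 8 ->
  F i Y (p + s *: E) <= - (eta / 2).
Proof.
move=> BZ BY Zi Yi G1 pG sG YZ w0 mu8 LG FZ.
have h1 := F_lip (p + s *: E) BY BZ Yi Zi.
have h2 : `|p + s *: E| <= (1 + C1) * G.
  apply: le_trans (ler_normD _ _) _; have := scale_unit_le s.
  by rewrite mulrDl mul1r; lra.
have h3 : L * `|Y - Z| * `|p + s *: E| <= L * (d + 2 * w) * ((1 + C1) * G).
  by rewrite ler_pM ?mulr_ge0 // ler_wpM2l.
lra.
Qed.

(* [lra] slows down with the size of the context, and fails once variables of the
   section are cleared. *)
Ltac local_lra :=
  clear -R m E E1 F u v Z1 r eta L M M0 c0 mu r0 eta0 L0 M_0 M00 c00 muP F_lip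
    F_lip_jet F_qconvex F_coercive uu vu uvmax u_side u_flat u_tangential
    v_side v_flat; lra.

Lemma interface_comparison : False.
Proof.
have C10 := C1_ge0; have eta_gt0 := eta0; have M_ge0 := M_0.
have [dmu dmu0 dmuP] := muP (ltac:(by rewrite divr_gt0) : 0 < eta / 8).
(* [A] combines the Lipschitz constant with the growth [(1 + C1) G] of the full jet. The radius [e]
   must be fixed before [p] is known, so it may involve [A] but not [G]. *)
have [A AE] : exists A : R, A = L * (1 + C1) by exists (L * (1 + C1)).
have A0 : 0 <= A by rewrite AE mulr_ge0 // addr_ge0.
pose e : R := Num.min r (Num.min (dmu / 4) (eta / (64 * (A + 1)))).
have A1 : 0 < 64 * (A + 1) by lra.
have e0 : 0 < e by rewrite !lt_min r0 !divr_gt0.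
have er : e <= r by rewrite ge_min lexx.
have edmu : e <= dmu / 4 by rewrite !ge_min lexx orbT.
have eA : A * e <= eta / 64.
  have : e <= eta / (64 * (A + 1)) by rewrite !ge_min lexx !orbT.
  rewrite ler_pdivlMr // => H; rewrite ler_pdivlMr //; move: H.
  by have := ltW e0; lra.
have [c [Zb [Yb [[cp Zbe Ybe ZYE de] ZYmax]]]] := tangential_doubling E1 r0 uu vu e0 er uvmax.
have Zbr : `|Zb - Z1| < r by lra.
have Ybr : `|Yb - Z1| < r by lra.
pose d := `|Zb - Yb|.
have d0 : 0 <= d by exact: normr_ge0.
have d2e : d <= 2 * e.
  by rewrite /d -(subrKA Z1) (le_trans (ler_normD _ _)) // (distrC Z1); lra.
(* [p] is the frozen tangential jet; below, [s] is a normal slope at which both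
   Hamiltonians are small, and [s + g], [s + t * g] are the normal slopes seen by
   [u] and [v]. *)
pose p : X := (2 / c) *: tangential E (Zb - Yb).
have tE : tangential E (Zb - Yb) = Zb - Yb by apply: tangential_id; rewrite !pdE; lra.
have pE : pd p E = 0 by rewrite /p pdZl tangential_normal // mulr0.
have c2 : 0 <= 2 / c by rewrite divr_ge0 // ltW.
have pn : `|p| = 2 / c * d by rewrite /p tE normrZ ger0_norm.
pose G : R := 2 + `|p|.
have G1 : 1 <= G by rewrite /G; have := normr_ge0 p; lra.
(* The jet [p] may be large, but [d |p| = 2 d^2 / c] is at most [2 e]: the small distance
   compensates for it. The remaining [2 d] is at most [4 e]. *)
have dG : d * G <= 6 * e.
  rewrite /G pn mulrDr; have -> : d * (2 / c * d) = 2 * (d ^+ 2 / c) by ring.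
  move: de; rewrite -/d; lra.
have [w [[w0 w1 wL] [wM wmu wN]]] : exists w : R, [/\ 0 < w, w <= 1 & 2 * w * (A * G) <= eta / 64]
   /\ [/\ 2 * (M * w) <= eta / 8, 2 * w <= dmu / 4 &
     pd Zb E != 0 -> m.+1%:R * w < `|pd Zb E|].
  (* If [Zb] is off the interface, [b] keeps all points within [w] of [Zb] or [Yb] on its side. *)
  pose b : R := if pd Zb E == 0 then 1 else `|pd Zb E| / (2 * m.+1%:R).
  have b0 : 0 < b by rewrite /b; case: eqP => // /eqP ?; rewrite divr_gt0 ?normr_gt0 ?mulr_gt0.
  pose w : R := Num.min 1 (Num.min b (Num.min (dmu / 8)
     (Num.min (eta / (128 * (A * G + 1))) (eta / (16 * (M + 1)))))).
  have AG : 0 < 128 * (A * G + 1).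
    by have : 0 <= A * G by [rewrite mulr_ge0 //; lra]; lra.
  have M1 : 0 < 16 * (M + 1) by rewrite mulr_gt0 // ltr_wpDl.
  have w0 : 0 < w by rewrite !lt_min ltr01 b0 !divr_gt0.
  exists w; split; split=> //.
  - by rewrite ge_min lexx.
  - have : w <= eta / (128 * (A * G + 1)) by rewrite !ge_min lexx !orbT.
    by rewrite ler_pdivlMr // => H; rewrite ler_pdivlMr //; lra.
  - have : w <= eta / (16 * (M + 1)) by rewrite !ge_min lexx !orbT.
    by rewrite ler_pdivlMr // => H; rewrite ler_pdivlMr //; lra.
  - have : w <= dmu / 8 by rewrite !ge_min lexx !orbT.
    lra.
  - move=> /negPf Zb0; have : w <= b by rewrite !ge_min lexx !orbT.
    rewrite /b Zb0 ler_pdivlMr ?mulr_gt0 // => H.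
    have : 0 < w * m.+1%:R by rewrite mulr_gt0.
    by move: H; rewrite mulrCA (mulrC w); lra.
have addNr' (a b : X) : a + b - a = b by rewrite addrAC subrr add0r.
have key i Z' Y (s' : R) : B Z' -> B Y -> on_closed_side i Z' -> on_closed_side i Y ->
    `|s'| <= C1 * G -> `|Y - Z'| <= d + 2 * w ->
    F i Z' (p + s' *: E) <= - eta + eta / 8 -> F i Y (p + s' *: E) <= - (eta / 2).
  move=> BZ BY Zi Yi sG YZ FZ.
  apply: (transfer BZ BY Zi Yi G1 _ sG YZ (ltW w0)) => //.
  - by rewrite /G lerDr.
  - by apply: dmuP => //; lra.
  - have -> : L * (d + 2 * w) * ((1 + C1) * G) = A * (d * G) + 2 * w * (A * G) by rewrite AE; ring.
    have : A * (d * G) <= A * (6 * e) by rewrite ler_wpM2l.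
    rewrite (mulrCA A 6 e); lra.
have close Y Z' (e1 e2 : R) : `|Y - Yb| <= e1 -> `|Z' - Zb| <= e2 -> `|Y - Z'| <= d + (e1 + e2).
  move=> h1 h2; rewrite -(subrKA Yb) (le_trans (ler_normD _ _)) //.
  have : `|Yb - Z'| <= d + e2.
    by rewrite -(subrKA Zb) (le_trans (ler_normD _ _)) // (distrC Yb) (distrC Zb Z') lerD.
  lra.
have jet_small i Z' P (ez : X) : B Z' -> on_closed_side i Z' -> `|ez| <= w ->
    F i Z' (P + ez) <= - eta -> F i Z' P <= - eta + eta / 8.
  move=> BZ Zi ezw FZ; have := F_lip_jet P (P + ez) BZ Zi.
  rewrite opprD addNKr normrN.
  have : M * `|ez| <= M * w by rewrite ler_wpM2l.
  by move: FZ wM eta_gt0; local_lra.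
have normal_slope i Z' (s' : R) (ez : X) : B Z' -> on_closed_side i Z' -> `|ez| <= w ->
    F i Z' (p + s' *: E + ez) <= - eta -> `|s'| <= C1 * G.
  move=> BZ Zi ezw FZ; apply: (@slope_bound i Z' (p + ez)) => //.
    by apply: le_trans (ler_normD _ _) _; rewrite /G; lra.
  by rewrite addrAC; lra.
have [Zb0|Zb0] := eqVneq (pd Zb E) 0; last first.
  have [i0 Zi0] : exists i, on_side i Zb by case: (side_cases Zb) => // -[]; move/eqP: Zb0.
  (* Both points remain on one side, so no bending is required: [k] is the identity and [s = 0].
     Coercivity still bounds the normal slope [g]. *)
  have [e1 e10 H1] := normal_doubling E1 r0 uu vu 0 cp w0 Zbr Ybr ZYE ZYmax.
  have [||||Z [Y [eZ [eY]]]] := H1 e1 0 0 id (fun=> 1) e10 (lexx _) _ _ _ _ (erefl _).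
  - by rewrite expr0n mulr_ge0 // ltW.
  - by move=> z; rewrite subrr normr0.
  - by move=> _; rewrite ler01 lexx.
  - by move=> z y; rewrite mul1r subrr normr0 mul0r.
  rewrite /= mul1r !add0r; set g := 2 / e1 * _ => -[[Zw Yw eZw eYw] [Zr Yr uZ vY]].
  have near_side (W : X) : `|W - Zb| < w \/ `|W - Yb| < w -> on_side i0 W.
    move=> H; apply: same_side Zi0 _.
    have mw (Z' : X) : `|W - Z'| < w -> `|pd (W - Z') E| < `|pd Zb E|.
      move=> h; apply: le_lt_trans (pd_unit_le_norm E1 _) _; apply: le_lt_trans (wN Zb0).
      by rewrite ler_wpM2l // ltW.
    by case: H => /mw; rewrite !pdE // ZYE.
  have Zs := near_side Z (or_introl Zw).
  have Ys := near_side Y (or_intror Yw).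
  have FZ := u_side Zr Zs uZ.
  have FY := v_side Yr Ys vY.
  have BZ : B Z := ltW Zr.
  have BY : B Y := ltW Yr.
  have Zc := on_sideW Zs; have Yc := on_sideW Ys.
  have gG := normal_slope _ _ _ _ BZ Zc eZw FZ.
  have FZ' := jet_small _ _ _ _ BZ Zc eZw FZ.
  have YZ : `|Y - Z| <= d + 2 * w.
    by have := close _ _ _ _ (ltW Yw) (ltW Zw); rewrite -mulr2n -[in X in X -> _](mulr_natl w).
  have FY' := key i0 Z Y g BZ BY Zc Yc gG YZ FZ'.
  have := F_lip_jet (p + g *: E + eY) (p + g *: E) BY Yc.
  rewrite addNr' => h.
  have : M * `|eY| <= M * w by rewrite ler_wpM2l.
  by move: h FY FY' wM eta_gt0; local_lra.
have Yb0 : pd Yb E = 0 by rewrite -ZYE.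
have [s sP] : exists s : R, forall i, F i Zb (p + s *: E) <= - eta.
  (* [Yb] is held fixed. As it lies on the interface, the constrained maximum compares [u] at all
     nearby interface points, which is what the tangential inequality tests. *)
  apply: u_tangential => //; apply: (@superjet_sub _ _ _ _ (fun W => c^-1 * tsq E (W - Yb))).
    rewrite /p mulrC -scalerA; apply: superjetZ (superjet_tsq E _ _ _).
    by rewrite invr_ge0 ltW.
  apply: filterS (near_norm_lt Zbr) => W Wr W0.
  have := ZYmax W Yb (ltW Wr) (ltW Ybr); rewrite Yb0 => /(_ W0).
  by rewrite !(mulrC c^-1); local_lra.
have cs i Z' : pd Z' E = 0 -> on_closed_side i Z' by rewrite /on_closed_side => ->; rewrite mulr0.
have BZb : B Zb := ltW Zbr.
have sG : `|s| <= C1 * G.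
  apply: (@slope_bound true Zb p) => //; first exact: cs.
    by rewrite /G lerDr.
  by have := sP true; move: eta_gt0; local_lra.
have [e1 e10 H1] := normal_doubling E1 r0 uu vu s cp w0 Zbr Ybr ZYE ZYmax.
(* With [a = h^2] and [kappa = h^3], both [a^2 / kappa] and [kappa / a] equal [h]: the first must be
   small for [normal_doubling], the second yields [t^2 <= 4 h (C1 G)]. Since [|g| <= 2 (C1 G)], [D]
   is such that [(t g)^2 <= h D <= w^2]. *)
pose D : R := 16 * (C1 * G) ^+ 3 + 1.
have G0 : 0 <= G := le_trans ler01 G1.
have D1 : 1 <= D by rewrite /D lerDr mulr_ge0 // exprn_ge0 // mulr_ge0.
pose h : R := Num.min 1 (Num.min e1 (w ^+ 2 / D)).
have D0 : 0 < D := lt_le_trans ltr01 D1.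
have h0 : 0 < h by rewrite !lt_min ltr01 e10 divr_gt0 ?exprn_gt0.
have h1 : h <= 1 by rewrite ge_min lexx.
have he1 : h <= e1 by rewrite !ge_min lexx orbT.
have hD : h * D <= w ^+ 2 by rewrite -ler_pdivlMr // !ge_min lexx !orbT.
have a0 : 0 < h ^+ 2 by rewrite exprn_gt0.
have k0 : 0 < h ^+ 3 by rewrite exprn_gt0.
have [|||Z [Y [eZ [eY]]]] := H1 (h ^+ 3) (h ^+ 2) (3 / h ^+ 2) (kink (h ^+ 2)) (kink' (h ^+ 2))
   k0 _ _ (fun z => kink_dist z a0) (fun z => kink'_bounds z a0) (fun z y => kink_quad z y a0).
- apply: le_trans he1; rewrite exprS ler_piMr ?(ltW h0) //.
  by rewrite expr_le1 // ltW.
- rewrite -exprM [leLHS]exprSr; rewrite ler_wpM2l //; exact: ltW.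
- by rewrite Yb0 kink0.
rewrite /=; set g := 2 / h ^+ 3 * _; set t := kink' _ _ => -[[Zw Yw eZw eYw] [Zr Yr uZ vY]].
have BZ : B Z := ltW Zr.
have BY : B Y := ltW Yr.
have t01 : 0 <= t <= 1 := kink'_bounds _ a0.
(* At [Zb] the slope [s] serves both sides, so it transfers to [Y] whatever the side of [Y]. *)
have FYs i : on_closed_side i Y -> F i Y (p + s *: E) <= - (eta / 2).
  move=> Yi; apply: (@key i Zb) => //; first exact: cs.
    have := close Y Zb w 0 (ltW Yw); rewrite subrr normr0 lexx => /(_ isT).
    by move: w0; local_lra.
  by have := sP i; move: eta_gt0; local_lra.
have finish i : on_closed_side i Y -> F i Y (p + (s + t * g) *: E) <= - (eta / 2) + M * w ->
    F i Y (p + (s + t * g) *: E + eY) < 0.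
  move=> Yi FY; have := F_lip_jet (p + (s + t * g) *: E + eY) (p + (s + t * g) *: E) BY Yi.
  rewrite addNr' => h2.
  have : M * `|eY| <= M * w by rewrite ler_wpM2l.
  by move: h2 FY wM eta_gt0; local_lra.
have small i : on_closed_side i Y -> `|t * g| <= w -> F i Y (p + (s + t * g) *: E + eY) < 0.
  move=> Yi tgw; apply: finish => //.
  have := F_lip_jet (p + (s + t * g) *: E) (p + s *: E) BY Yi.
  rewrite scalerDl addrA addNr' => h2.
  have : M * `|(t * g) *: E| <= M * w by rewrite ler_wpM2l // (le_trans (scale_unit_le _)).
  by have := FYs i Yi; move: h2; local_lra.
have [[i Yi]|[Y0 Yi]] := side_cases Y; last first.
  have [i] := v_flat Yr Y0 vY.
  rewrite leNgt => /negP; apply; apply: small => //.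
  by rewrite /t Y0 kink'0 // mul0r normr0 ltW.
have Yc := on_sideW Yi.
have := v_side Yr Yi vY; rewrite leNgt => /negP; apply.
have [Zi|Zi] := ltP 0 (side_sign i * pd Z E).
  have Zc := on_sideW Zi.
  have FZ := u_side Zr Zi uZ.
  have gG := normal_slope _ _ _ _ BZ Zc eZw FZ.
  have FZ' := jet_small _ _ _ _ BZ Zc eZw FZ.
  have YZ : `|Y - Z| <= d + 2 * w.
    by have := close _ _ _ _ (ltW Yw) (ltW Zw); rewrite -mulr2n -[in X in X -> _](mulr_natl w).
  have FY' := key i Z Y (s + g) BZ BY Zc Yc gG YZ FZ'.
  apply: finish => //.
  have := F_qconvex BY Yc t01 (FYs i Yc) FY'.
  have -> : (1 - t) *: (p + s *: E) + t *: (p + (s + g) *: E) = p + (s + t * g) *: E.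
    by spacetime_ring.
  move=> h2; apply: le_trans h2 _; rewrite lerDl mulr_ge0 //; exact: ltW.
apply: small => //.
(* The side [j] may differ from [i]: the inequality for [u] serves only to bound [g] and is never
   compared with that for [v]. *)
have [j Zj FZ] := u_some_side Zr uZ.
have gG := normal_slope _ _ _ _ BZ Zj eZw FZ.
have g2 : `|g| <= 2 * (C1 * G).
  have -> : g = (s + g) - s by ring.
  by apply: le_trans (ler_normB _ _) _; move: gG sG; local_lra.
pose kY := kink (h ^+ 2) (pd Y E).
(* [k(y_N)] and [x_N] have opposite signs in the weak sense, so [k(y_N)] is dominated by
   [x_N - k(y_N)], which is [kappa g / 2]. *)
have kYZ : `|kY| <= `|pd Z E - kY|.
  have h3 : 0 <= side_sign i * kY.
    move: (ltW Yi); rewrite /side_sign; case: (i) => yi; rewrite ?mul1r.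
      by apply: kink_ge0 => //; move: yi; rewrite mul1r.
    by rewrite mulN1r -kinkN kink_ge0 //; move: yi; rewrite mulN1r.
  have sn (x : R) : `|x| = `|side_sign i * x|.
    by rewrite /side_sign; case: (i); rewrite ?mul1r ?mulN1r ?normrN.
  rewrite sn [leRHS]sn mulrBr (ger0_norm h3) ler0_norm; move: h3 Zi; local_lra.
have kYg : `|kY| <= h ^+ 3 * (C1 * G).
  have : `|g| = 2 / h ^+ 3 * `|pd Z E - kY| by rewrite /g normrM ger0_norm // divr_ge0 // ltW.
  move=> gE; move: g2; rewrite gE -mulrA ler_pM2l // mulrC ler_pdivrMr // mulrC.
  exact: le_trans kYZ.
have t2 : t ^+ 2 <= 4 * (h * (C1 * G)).
  apply: le_trans (kink'_sqr _ a0) _; rewrite ler_pdivrMr // -/kY.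
  have -> : 4 * (h * (C1 * G)) * h ^+ 2 = 4 * (h ^+ 3 * (C1 * G)) by ring.
  by rewrite ler_wpM2l.
rewrite -(@ler_pXn2r _ 2) ?nnegrE ?(ltW w0) // real_normK ?num_real // exprMn.
have g4 : g ^+ 2 <= (2 * (C1 * G)) ^+ 2.
  by rewrite -(real_normK (num_real g)) ler_pXn2r ?nnegrE //; apply: le_trans g2.
apply: (@le_trans _ _ (4 * (h * (C1 * G)) * (2 * (C1 * G)) ^+ 2)).
  by rewrite ler_pM ?sqr_ge0.
apply: le_trans hD; have -> : 4 * (h * (C1 * G)) * (2 * (C1 * G)) ^+ 2 = h * (16 * (C1 * G) ^+ 3) by ring.
by rewrite ler_wpM2l /D ?(ltW h0) // lerDl.
Qed.

End Interface.

(** * The Hamiltonians *)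

Section Hamiltonian.
Context {R : realType} {n : nat} {A : metricType R}.
Local Notation V := 'rV[R]_(n + 1).
Local Notation X := (V * R)%type.
Local Notation dim := ((n + 1)%:R : R).
Context (D : set V) (T : R) (b : V -> R -> A -> V) (l : V -> R -> A -> R).
Context (Mb Lb Ml : R) (ml : R -> R) (alpha0 : A).
Hypothesis bC1 : cond_C1 D T b Mb Lb.
Hypothesis ml_mod : modulus ml.
Hypothesis lC2 : cond_C2 D T l Ml ml.
Implicit Types (z p : V) (s : R) (Z P : X).

Definition in_data Z : Prop := D Z.1 /\ 0 <= Z.2 <= T.

Lemma b_norm_le Z alpha : in_data Z -> `|b Z.1 Z.2 alpha| <= Mb.
Proof.
by case=> DZ TZ; have [_ _ H _] := bC1; apply: le_trans (norm_le_enorm _) (H _ _ _ DZ TZ).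
Qed.

Lemma Mb_ge0 Z : in_data Z -> 0 <= Mb.
Proof. by move=> /(b_norm_le alpha0); exact: le_trans. Qed.

Lemma dot_b_le Z alpha p : in_data Z -> `|dot (b Z.1 Z.2 alpha) p| <= dim * Mb * `|p|.
Proof.
move=> /(b_norm_le alpha) H; apply: le_trans (dot_le_norm _ _) _.
by rewrite ler_wpM2r // ler_wpM2l.
Qed.

Lemma l_norm_le Z alpha : in_data Z -> `|l Z.1 Z.2 alpha| <= Ml.
Proof. by case=> DZ TZ; have [_ H _] := lC2; exact: H. Qed.

Lemma running_le_hamiltonian Z p alpha : in_data Z ->
  - dot (b Z.1 Z.2 alpha) p - l Z.1 Z.2 alpha <= hamiltonian b l Z.1 Z.2 p.
Proof.
move=> DZ; apply: ub_le_sup; last by exists alpha.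
exists (dim * Mb * `|p| + Ml) => _ [a _ <-].
have := dot_b_le a p DZ; have := l_norm_le a DZ; rewrite !ler_norml.
by move=> /andP[h1 h2] /andP[h3 h4]; lra.
Qed.

(** [alpha0] is what makes this valid: the real [sup] of an empty set is a default value, not a
    least upper bound. *)
Lemma hamiltonian_le Z p c :
  (forall alpha, - dot (b Z.1 Z.2 alpha) p - l Z.1 Z.2 alpha <= c) ->
  hamiltonian b l Z.1 Z.2 p <= c.
Proof.
move=> H; apply: ge_sup; last by move=> _ [alpha _ <-].
by exists (- dot (b Z.1 Z.2 alpha0) p - l Z.1 Z.2 alpha0), alpha0.
Qed.

Definition evolution_hamiltonian Z P : R := P.2 + hamiltonian b l Z.1 Z.2 P.1.
Local Notation F := evolution_hamiltonian.

Lemma evolution_le Z P c :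
  (forall alpha, P.2 - dot (b Z.1 Z.2 alpha) P.1 - l Z.1 Z.2 alpha <= c) -> F Z P <= c.
Proof.
move=> H; rewrite /F -lerBrDl; apply: hamiltonian_le => alpha.
by have := H alpha; lra.
Qed.

Lemma running_le_evolution Z P alpha : in_data Z ->
  P.2 - dot (b Z.1 Z.2 alpha) P.1 - l Z.1 Z.2 alpha <= F Z P.
Proof.
by move=> DZ; rewrite /F; have := running_le_hamiltonian P.1 alpha DZ; lra.
Qed.

Lemma norm_fst P : `|P.1| <= `|P|.
Proof. by rewrite prod_normE le_max lexx. Qed.

Lemma norm_snd P : `|P.2| <= `|P|.
Proof. by rewrite prod_normE le_max lexx orbT. Qed.

Lemma enorm_space_time Z Z' :
  enorm (Z.1 - Z'.1) + `|Z.2 - Z'.2| <= (dim + 1) * `|Z - Z'|.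
Proof.
rewrite mulrDl mul1r; apply: lerD; last exact: (norm_snd (Z - Z')).
by apply: le_trans (enorm_le_norm _) _; rewrite ler_wpM2l // (norm_fst (Z - Z')).
Qed.

Lemma evolution_lip_jet Z P P' : in_data Z ->
  F Z P <= F Z P' + (dim * Mb + 1) * `|P - P'|.
Proof.
move=> DZ; apply: evolution_le => alpha.
have := running_le_evolution P' alpha DZ.
have := dot_b_le alpha (P' - P).1 DZ; rewrite [(P' - P).1]/= dotDr dotNr => h1.
have := norm_snd (P - P'); rewrite [(P - P').2]/= => h2.
have h3 : dim * Mb * `|P'.1 - P.1| <= dim * Mb * `|P - P'|.
  rewrite ler_wpM2l ?mulr_ge0 ?(Mb_ge0 DZ) // distrC; exact: (norm_fst (P - P')).
move: h1 h2; rewrite !ler_norml => /andP[h1 h1'] /andP[h2 h2'].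
rewrite mulrDl mul1r; lra.
Qed.

Lemma b_lip Z Z' alpha : in_data Z -> in_data Z' ->
  `|b Z.1 Z.2 alpha - b Z'.1 Z'.2 alpha| <= `|Lb| * ((dim + 1) * `|Z - Z'|).
Proof.
move=> [DZ TZ] [DZ' TZ']; have [_ _ _ H] := bC1.
apply: le_trans (norm_le_enorm _) _; apply: le_trans (H _ _ _ _ alpha DZ TZ DZ' TZ') _.
apply: le_trans (ler_wpM2l (normr_ge0 _) (enorm_space_time Z Z')).
by rewrite ler_wpM2r ?addr_ge0 ?enorm_ge0 // ler_norm.
Qed.

Lemma evolution_lip Z Z' P : in_data Z -> in_data Z' ->
  F Z P <= F Z' P + dim * `|Lb| * (dim + 1) * `|Z - Z'| * `|P|
    + ml ((dim + 1) * `|Z - Z'|).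
Proof.
move=> DZ DZ'; apply: evolution_le => alpha.
have := running_le_evolution P alpha DZ'.
have h1 : `|dot (b Z'.1 Z'.2 alpha - b Z.1 Z.2 alpha) P.1| <=
    dim * `|Lb| * (dim + 1) * `|Z - Z'| * `|P|.
  apply: le_trans (dot_le_norm _ _) _; rewrite distrC.
  apply: ler_pM => //; last exact: norm_fst.
  by rewrite -!mulrA ler_wpM2l // b_lip.
have h2 : `|l Z.1 Z.2 alpha - l Z'.1 Z'.2 alpha| <= ml ((dim + 1) * `|Z - Z'|).
  move: (DZ) (DZ') => [? ?] [? ?]; have [_ _ H] := lC2.
  apply: le_trans (H _ _ _ _ alpha _ _ _ _) _ => //.
  have [_ mono _] := ml_mod; apply: mono (enorm_space_time Z Z').
  by rewrite addr_ge0 ?enorm_ge0.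
move: h1 h2; rewrite dotDl dotNl !ler_norml => /andP[h1 h1'] /andP[h2 h2'].
lra.
Qed.

(** A supremum of affine functions of the jet has convex sublevel sets. *)
Lemma evolution_qconvex Z P P' (t c : R) : in_data Z -> 0 <= t <= 1 ->
  F Z P <= c -> F Z P' <= c -> F Z ((1 - t) *: P + t *: P') <= c.
Proof.
move=> DZ /andP[t0 t1] FP FP'; apply: evolution_le => alpha /=.
have h1 := le_trans (running_le_evolution P alpha DZ) FP.
have h2 := le_trans (running_le_evolution P' alpha DZ) FP'.
rewrite dotDr !dotZr !scale_regular.
have t1' : 0 <= 1 - t by rewrite subr_ge0.
have := ler_wpM2l t0 h2; have := ler_wpM2l t1' h1.
set x := dot _ _; set y := dot _ _; set L := l _ _ _; lra.
Qed.

(* Normal controllability at [Z'] persists nearby and makes the Hamiltonian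
   coercive in the normal direction. *)
Lemma evolution_coercive Z Z' P (s delta : R) :
  in_data Z -> in_data Z' -> 0 < delta ->
  `[- delta, delta] `<=` [set dot (b Z'.1 Z'.2 alpha) eN | alpha in setT] ->
  dim * (`|Lb| * ((dim + 1) * `|Z - Z'|)) <= delta / 2 -> `|(eN : V)| <= 1 ->
  delta / 2 * `|s| <= (dim * Mb + Ml + 1) * (1 + `|P|) + F Z (P + s *: (eN, 0)).
Proof.
move=> DZ DZ' delta0 C4 close e1.
(* At [Z'] a control opposes the sign of [s] at full speed [delta]; the Lipschitz bound on [b] loses
   at most half of it at [Z]. *)
have [alpha as0] : exists alpha, - (s * dot (b Z'.1 Z'.2 alpha) eN) = delta * `|s|.
  have [s0|s0] := leP 0 s.
    have [|alpha _ E] := C4 (- delta); first by rewrite /= in_itv /=; lra.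
    by exists alpha; rewrite E ger0_norm //; ring.
  have [|alpha _ E] := C4 delta; first by rewrite /= in_itv /=; lra.
  by exists alpha; rewrite E ltr0_norm //; ring.
have h1 := running_le_evolution (P + s *: (eN, 0)) alpha DZ.
move: h1; rewrite /= dotDr dotZr !scale_regular mulr0 addr0.
have h2 : `|dot (b Z.1 Z.2 alpha - b Z'.1 Z'.2 alpha) eN| <= delta / 2.
  apply: le_trans (dot_le_norm _ _) _; apply: le_trans close.
  apply: (@le_trans _ _ (dim * `|b Z.1 Z.2 alpha - b Z'.1 Z'.2 alpha|)).
    by rewrite ler_piMr ?mulr_ge0.
  by rewrite ler_wpM2l // b_lip.
have h3 : s * dot (b Z.1 Z.2 alpha - b Z'.1 Z'.2 alpha) eN <= `|s| * (delta / 2).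
  apply: le_trans (ler_norm _) _; by rewrite normrM ler_wpM2l.
have h4 := dot_b_le alpha P.1 DZ.
have h5 := l_norm_le alpha DZ.
have h6 : dim * Mb * `|P.1| <= dim * Mb * `|P|.
  by rewrite ler_wpM2l ?norm_fst // mulr_ge0 ?(Mb_ge0 DZ).
have h7 := norm_snd P.
have Ml0 : 0 <= Ml := le_trans (normr_ge0 _) h5.
have h8 : 0 <= Ml * `|P| by rewrite mulr_ge0.
have h9 : 0 <= dim * Mb by rewrite mulr_ge0 ?(Mb_ge0 DZ).
move: h3; rewrite dotDl dotNl mulrDr mulrN.
move: h4 h5 h7; rewrite !ler_norml => /andP[h4 h4'] /andP[h5 h5'] /andP[h7 h7'].
set x := dot (b Z.1 Z.2 alpha) eN; set y := dot (b Z'.1 Z'.2 alpha) eN in as0 *.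
set k := dim * Mb in h6 h9 *; move: as0 h4 h4' h5 h5' h6 h7 h7' h8 h9.
set f := evolution_hamiltonian _ _.
set d1 := dot _ _; set l1 := l _ _ _; set np := `|P|; set ns := `|s|; set k1 := k * `|P.1|.
move=> *; lra.
Qed.

(** [A0] mixes one control of each side only. In the duality, a mixture of two controls of the same
    side is therefore replaced by a single control. *)
Lemma C3_combine Z alpha alpha' (t : R) : cond_C3 D T b l -> in_data Z -> 0 <= t <= 1 ->
  exists a, b Z.1 Z.2 a = t *: b Z.1 Z.2 alpha + (1 - t) *: b Z.1 Z.2 alpha' /\
    l Z.1 Z.2 a = t * l Z.1 Z.2 alpha + (1 - t) * l Z.1 Z.2 alpha'.
Proof.
move=> C3 [DZ TZ] /andP[t0 t1]; have [_ conv] := C3 _ _ DZ TZ.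
have inBL a : (b Z.1 Z.2 a, l Z.1 Z.2 a) \in
    [set (b Z.1 Z.2 alpha, l Z.1 Z.2 alpha) | alpha in [set: A]].
  by rewrite inE; exists a.
have := conv _ _ (Itv01 t0 t1) (inBL alpha) (inBL alpha').
rewrite inE => -[a _ /= []] => ba la; exists a; split; [exact: ba | exact: la].
Qed.

End Hamiltonian.

(** * From viscosity inequalities to superjets *)

Lemma diff_quadratic_remainder {R : realType} {V : normedModType R} (f : V -> R)
    (L : {linear V -> R}) (x : V) (c : R) : continuous L ->
  (forall k, `|f (k + x) - (f x + L k)| <= c * `|k| ^+ 2) ->
  differentiable f x /\ 'd f x = L :> (V -> R).
Proof.
move=> Lc fL.
have dL : f \o shift x = cst (f x) + L +o_ 0 id.
  apply/eqaddoP => e e0.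
  have c0 : 0 < `|c| + 1 by rewrite ltr_wpDl.
  have h0 : `|(0 : V) - 0| < e / (`|c| + 1) by rewrite subrr normr0 divr_gt0.
  apply: filterS (near_norm_lt h0) => k; rewrite subr0 ltr_pdivlMr // => kd.
  apply: le_trans (fL k) _; rewrite expr2 mulrA ler_wpM2r //.
  apply: le_trans (ltW kd); rewrite mulrC ler_wpM2l //.
  by apply: le_trans (ler_norm _) _; rewrite lerDl.
have dE := diff_unique Lc dL.
split; last exact: dE.
by apply/diff_locallyP; rewrite dE.
Qed.

Section QuadraticTests.
Context {R : realType} {m : nat}.
Local Notation X := ('rV[R]_m * R)%type.
Implicit Types (Z W P : X) (C : R).

Definition quadratic P C Z W : R := pd P W + C * pd (W - Z) (W - Z).

Definition quadratic_grad P C Z W : X := P + (2 * C) *: (W - Z).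

Lemma continuous_pdl P : continuous (pd P : X -> R).
Proof.
by apply: continuous_pd => W; [exact: cvg_cst | exact: cvg_id].
Qed.

Lemma quadratic_diff P C Z W :
  differentiable (quadratic P C Z) W /\
  'd (quadratic P C Z) W = pd (quadratic_grad P C Z W) :> (X -> R).
Proof.
set Q := quadratic_grad P C Z W.
have lin : linear (pd Q : X -> R).
  by move=> a x y; rewrite pdDr pdZr.
pose LM := GRing.isLinear.Build _ _ _ _ _ lin.
pose L : {linear X -> R} := HB.pack (pd Q : X -> R) LM.
have Lc : continuous (L : X -> R) by exact: continuous_pdl.
have LQ k : `|quadratic P C Z (k + W) - (quadratic P C Z W + L k)|
    <= `|C| * m.+1%:R * `|k| ^+ 2.
  have -> : quadratic P C Z (k + W) - (quadratic P C Z W + L k) = C * pd k k.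
    rewrite /L /= /quadratic /Q /quadratic_grad !pdE.
    by rewrite (pdC Z k) (pdC Z W) (pdC W k); ring.
  by rewrite normrM -mulrA ler_wpM2l // expr2 mulrA pd_le_norm.
exact: (@diff_quadratic_remainder _ _ _ L _ _ Lc LQ).
Qed.

Lemma derive_quadratic P C Z W (w : X) :
  'D_w (quadratic P C Z) W = pd (quadratic_grad P C Z W) w.
Proof. by have [d dE] := quadratic_diff P C Z W; rewrite deriveE // dE. Qed.

Lemma quadratic_C1 (Q : set X) P C Z : C1_on Q (quadratic P C Z).
Proof.
move=> W _; split; first exact: (quadratic_diff P C Z W).1.
move=> w.
have -> : 'D_w (quadratic P C Z) = fun W => pd P w + 2 * C * (pd w W - pd Z w).
  apply/funext => W'; rewrite derive_quadratic /quadratic_grad !pdE.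
  by rewrite (pdC w).
apply: cvgD; first exact: cvg_cst.
apply: cvgMr; apply: cvgB; last exact: cvg_cst.
exact: continuous_pdl.
Qed.

Lemma dot_delta (x : 'rV[R]_m) i : dot x (delta_mx 0 i) = x 0 i.
Proof.
rewrite /dot (bigD1 i) //= mxE !eqxx mulr1 big1 ?addr0 // => j /negPf ji.
by rewrite mxE eqxx ji mulr0.
Qed.

Lemma quadratic_jet P C Z : time_deriv (quadratic P C Z) Z = P.2 /\
  space_grad (quadratic P C Z) Z = P.1.
Proof.
have gE : quadratic_grad P C Z Z = P by rewrite /quadratic_grad subrr scaler0 addr0.
split.
  rewrite /time_deriv derive_quadratic gE /pd /= mulr1.
  by rewrite (_ : dot _ 0 = 0) ?add0r // /dot big1 // => i _; rewrite mxE mulr0.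
apply/rowP => i; rewrite /space_grad mxE derive_quadratic gE /pd /= mulr0 addr0.
exact: dot_delta.
Qed.

(** The quadratic bound of the superjet, without its constant term, is a [C^1] test function with
    jet [P] at [Z]. *)
Lemma visc_sub_superjet (Q D : set X) H u Z P : visc_sub Q D H u -> D Z ->
  superjet Q u Z P -> P.2 + H Z.1 Z.2 P.1 <= 0.
Proof.
move=> usub DZ [C uC]; have [tE gE] := quadratic_jet P C Z.
rewrite -tE -[X in H _ _ X]gE; apply: usub => //; first exact: quadratic_C1.
apply: filterS uC => W /=; rewrite /quadratic subrr pd0l mulr0 addr0 pdDr pdNr.
by set a := pd P W; set b := pd P Z; lra.
Qed.

Lemma visc_super_superjet (Q D : set X) H v Z P : visc_super Q D H v -> D Z ->
  superjet Q (fun W => - v W) Z (- P) -> 0 <= P.2 + H Z.1 Z.2 P.1.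
Proof.
move=> vsup DZ [C vC]; have [tE gE] := quadratic_jet P (- C) Z.
rewrite -tE -[X in H _ _ X]gE; apply: vsup => //; first exact: quadratic_C1.
apply: filterS vC => W /=; rewrite /quadratic subrr pd0l mulr0 addr0 pdNl pdDr pdNr.
by set a := pd P W; set b := pd P Z; set c := pd _ _; lra.
Qed.

Lemma superjetW (D D' : set X) u Z P : D' `<=` D -> superjet D u Z P -> superjet D' u Z P.
Proof.
move=> DD [C uC]; exists C.
have {}uC : \forall W \near Z, D W ->
  u W <= u Z + pd P (W - Z) + C * pd (W - Z) (W - Z) := uC.
by apply: filterS uC => W H /DD.
Qed.

End QuadraticTests.

(** * Normal and tangential components, duality for the tangential Hamiltonian *)

Section NormalVector.
Context {R : realType} {n : nat}.
Local Notation V := 'rV[R]_(n + 1).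

Lemma dot_eN (x : V) : dot x eN = x 0 (rshift n ord0).
Proof. exact: dot_delta. Qed.

Lemma dot_eN_eN : dot (eN : V) eN = 1.
Proof. by rewrite dot_eN mxE !eqxx. Qed.

Lemma eN_norm_le1 : `|(eN : V)| <= 1.
Proof. by apply: norm_le_coord => // i; rewrite mxE; case: (_ && _); rewrite ?normr1 ?normr0. Qed.

Lemma dot_tang_eN (p' : 'rV[R]_n) : dot (tang p') eN = 0.
Proof. by rewrite dot_eN /tang row_mxEr mxE. Qed.

Lemma tang_lsubmx (x : V) : dot x eN = 0 -> tang (lsubmx x) = x.
Proof.
rewrite dot_eN => x0; rewrite -[RHS]hsubmxK /tang; congr row_mx.
by apply/rowP => i; rewrite !mxE (ord1 i) x0.
Qed.

Lemma dot_tang (p' x' : 'rV[R]_n) : dot (tang p') (tang x') = dot p' x'.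
Proof.
rewrite /dot big_split_ord /=.
have -> : \sum_i tang p' 0 (rshift n i) * tang x' 0 (rshift n i) = 0.
  by apply: big1 => i _; rewrite !row_mxEr !mxE mul0r.
by rewrite addr0; apply: eq_bigr => i _; rewrite !row_mxEl.
Qed.

Lemma tangD (x y : 'rV[R]_n) : tang (x + y) = tang x + tang y.
Proof. by rewrite /tang add_row_mx addr0. Qed.

Lemma tangN (x : 'rV[R]_n) : tang (- x) = - tang x.
Proof. by rewrite /tang opp_row_mx oppr0. Qed.

End NormalVector.

(* Planar form of the duality between [HT] and the two Hamiltonians: a set whose
   convex hull meets the vertical axis only below height [h] lies below a line
   through [(0, h)]. *)
Lemma supporting_slope {R : realType} (G : set (R * R)) (h : R) :
  (forall q, G q -> q.1 = 0 -> q.2 <= h) ->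
  (forall q q', G q -> G q' -> 0 < q.1 -> q'.1 < 0 ->
     q.1 * q'.2 - q'.1 * q.2 <= h * (q.1 - q'.1)) ->
  (exists2 q, G q & 0 < q.1) -> (exists2 q, G q & q.1 < 0) ->
  exists s : R, forall q, G q -> q.2 - s * q.1 <= h.
Proof.
move=> G0 Gcross [q0 Gq0 q00] [q1 Gq1 q10].
(* [S] collects the slopes from [(0, h)] to the points right of the axis; the crossing hypothesis
   bounds them by every slope to a point left of it. *)
pose S := [set (q.2 - h) / q.1 | q in [set q | G q /\ 0 < q.1]].
have SG q' : G q' -> q'.1 < 0 -> ubound S ((q'.2 - h) / q'.1).
  move=> Gq' q'0 _ [q [Gq q_gt0] <-]; rewrite ler_pdivrMr // mulrAC ler_ndivlMr //.
  by have := Gcross q q' Gq Gq' q_gt0 q'0; lra.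
have Sne : S !=set0 by exists ((q0.2 - h) / q0.1), q0.
exists (sup S) => q Gq; case: (ltgtP q.1 0) => qs.
- have : sup S <= (q.2 - h) / q.1 by apply: ge_sup => //; exact: SG.
  by rewrite ler_ndivlMr //; lra.
- have : (q.2 - h) / q.1 <= sup S.
    by apply: ub_le_sup; [exists ((q1.2 - h) / q1.1); exact: SG | exists q].
  by rewrite ler_pdivrMr //; lra.
- by rewrite qs mulr0 subr0; exact: G0.
Qed.

Lemma crossing_le {R : realType} (x y x' y' h : R) : 0 < x -> x' < 0 ->
  (forall t, 0 <= t <= 1 -> t * x + (1 - t) * x' = 0 -> t * y + (1 - t) * y' <= h) ->
  x * y' - x' * y <= h * (x - x').
Proof.
move=> x0 x'0 H; have d0 : 0 < x - x' by lra.
(* This is the weight at which the segment meets the vertical axis. *)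
have t01 : 0 <= - x' / (x - x') <= 1.
  by rewrite divr_ge0 /= ?ler_pdivrMr //; lra.
have t0 : - x' / (x - x') * x + (1 - - x' / (x - x')) * x' = 0 by field; lra.
rewrite -ler_pdivrMr //; apply: le_trans (H _ t01 t0).
by rewrite le_eqVlt; apply/orP; left; apply/eqP; field; lra.
Qed.

Section Duality.
Context {R : realType} {n : nat} {A1 A2 : metricType R}.
Local Notation V := 'rV[R]_(n + 1).
Local Notation X := (V * R)%type.
Context (D1 D2 : set V) (T : R).
Context (b1 : V -> R -> A1 -> V) (b2 : V -> R -> A2 -> V).
Context (l1 : V -> R -> A1 -> R) (l2 : V -> R -> A2 -> R).
Context (Mb Lb Ml delta : R) (ml : R -> R) (Z : X).
Hypotheses (b1C1 : cond_C1 D1 T b1 Mb Lb) (b2C1 : cond_C1 D2 T b2 Mb Lb).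
Hypotheses (l1C2 : cond_C2 D1 T l1 Ml ml) (l2C2 : cond_C2 D2 T l2 Ml ml).
Hypotheses (C3_1 : cond_C3 D1 T b1 l1) (C3_2 : cond_C3 D2 T b2 l2).
Hypotheses (D1Z : in_data D1 T Z) (D2Z : in_data D2 T Z) (delta0 : 0 < delta).
Hypothesis C4_1 : `[- delta, delta] `<=` [set dot (b1 Z.1 Z.2 alpha) eN | alpha in setT].
Hypothesis C4_2 : `[- delta, delta] `<=` [set dot (b2 Z.1 Z.2 alpha) eN | alpha in setT].

Lemma running_le_HT p' a : A0 b1 b2 Z.1 Z.2 a ->
  - dot (bH b1 b2 Z.1 Z.2 a) (tang p') - lH l1 l2 Z.1 Z.2 a
    <= HT b1 b2 l1 l2 Z.1 Z.2 p'.
Proof.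
move=> aA0; apply: ub_le_sup; last by exists a.
exists ((n + 1)%:R * Mb * `|tang p'| + Ml) => _ [[[a1 a2] t] /= [/andP[t0 t1] _] <-].
rewrite /bH /lH /= dotDl !dotZl.
have := dot_b_le b1C1 a1 (tang p') D1Z; have := dot_b_le b2C1 a2 (tang p') D2Z.
have := l_norm_le l1C2 a1 D1Z; have := l_norm_le l2C2 a2 D2Z; rewrite !ler_norml.
set K := _ * `|tang p'|; set x2 := dot _ _; set x1 := dot _ _.
set y1 := l1 _ _ _; set y2 := l2 _ _ _.
move=> /andP[h1 _] /andP[h2 _] /andP[h3 _] /andP[h4 _].
have t1' : 0 <= 1 - t by rewrite subr_ge0.
have k1 : t * (- x1 - y1) <= t * (K + Ml) by rewrite ler_wpM2l //; lra.
have k2 : (1 - t) * (- x2 - y2) <= (1 - t) * (K + Ml) by rewrite ler_wpM2l //; lra.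
lra.
Qed.

(** Each control gives the planar point (normal drift, tangential running value), and
    [supporting_slope] is applied to the points of both sides together. A crossing between the sides
    is a mixture in [A0]; one within a side reduces, by convexity, to a single control with zero
    normal drift. Controllability provides points on both sides of the axis. *)
Lemma tangential_duality (p' : 'rV[R]_n) : exists s : R,
  hamiltonian b1 l1 Z.1 Z.2 (tang p' + s *: eN) <= HT b1 b2 l1 l2 Z.1 Z.2 p' /\
  hamiltonian b2 l2 Z.1 Z.2 (tang p' + s *: eN) <= HT b1 b2 l1 l2 Z.1 Z.2 p'.
Proof.
have d0 := delta0.
have [a1 _ a1E] := C4_1 (ltac:(by rewrite /= in_itv /=; lra) : `[- delta, delta]%classic delta).
have [a1' _ a1'E] := C4_1 (ltac:(by rewrite /= in_itv /=; lra) : `[- delta, delta]%classic (- delta)).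
have [a2 _ _] := C4_2 (ltac:(by rewrite /= in_itv /=; lra) : `[- delta, delta]%classic delta).
set h := HT b1 b2 l1 l2 Z.1 Z.2 p'.
pose q1 a := (dot (b1 Z.1 Z.2 a) eN, - dot (b1 Z.1 Z.2 a) (tang p') - l1 Z.1 Z.2 a).
pose q2 a := (dot (b2 Z.1 Z.2 a) eN, - dot (b2 Z.1 Z.2 a) (tang p') - l2 Z.1 Z.2 a).
pose G := [set q | (exists a, q = q1 a) \/ (exists a, q = q2 a)].
have G1 a : G (q1 a) by left; exists a.
have G2 a : G (q2 a) by right; exists a.
have mix a a' (t : R) : 0 <= t <= 1 -> t * (q1 a).1 + (1 - t) * (q2 a').1 = 0 ->
    t * (q1 a).2 + (1 - t) * (q2 a').2 <= h.
  move=> t01 t0; have := @running_le_HT p' (a, a', t).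
  rewrite /A0 /bH /lH /= !dotDl !dotZl => /(_ (conj t01 t0)) H.
  by apply: le_trans H; rewrite /q1 /q2 /=; lra.
have flat1 a : (q1 a).1 = 0 -> (q1 a).2 <= h.
  by move=> E; have := @mix a a2 1; rewrite ler01 lexx E subrr !mul1r !mul0r !addr0; exact.
have flat2 a : (q2 a).1 = 0 -> (q2 a).2 <= h.
  by move=> E; have := @mix a1 a 0; rewrite ler01 lexx E subr0 !mul1r !mul0r !add0r; exact.
have same1 a a' (t : R) : 0 <= t <= 1 -> t * (q1 a).1 + (1 - t) * (q1 a').1 = 0 ->
    t * (q1 a).2 + (1 - t) * (q1 a').2 <= h.
  move=> t01; have [c [bc lc]] := C3_combine a a' C3_1 D1Z t01.
  have := flat1 c; rewrite /q1 /= bc lc !dotDl !dotZl => H /H; apply: le_trans; lra.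
have same2 a a' (t : R) : 0 <= t <= 1 -> t * (q2 a).1 + (1 - t) * (q2 a').1 = 0 ->
    t * (q2 a).2 + (1 - t) * (q2 a').2 <= h.
  move=> t01; have [c [bc lc]] := C3_combine a a' C3_2 D2Z t01.
  have := flat2 c; rewrite /q2 /= bc lc !dotDl !dotZl => H /H; apply: le_trans; lra.
have [||||s sP] := @supporting_slope R G h.
- by move=> _ [[a ->]|[a ->]]; [exact: flat1 | exact: flat2].
- move=> _ _ [[a ->]|[a ->]] [[a' ->]|[a' ->]] pos neg; apply: crossing_le => // t t01 t0.
  + exact: same1.
  + exact: mix.
  + have := @mix a' a (1 - t); rewrite subKr addrC (addrC (t * _)) => H.
    have := H (ltac:(case/andP: t01 => ? ?; apply/andP; split; lra)).
    by rewrite addrC (addrC (_ * (q1 a').1)) t0 addrC; exact.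
  + exact: same2.
- by exists (q1 a1) => //; rewrite /q1 /= a1E.
- by exists (q1 a1') => //; rewrite /q1 /= a1'E oppr_lt0.
exists s; split; apply: ge_sup.
- by exists (- dot (b1 Z.1 Z.2 a1) (tang p' + s *: eN) - l1 Z.1 Z.2 a1), a1.
- by move=> _ [a _ <-]; have := sP _ (G1 a); rewrite /q1 /= dotDr dotZr; lra.
- by exists (- dot (b2 Z.1 Z.2 a2) (tang p' + s *: eN) - l2 Z.1 Z.2 a2), a2.
- by move=> _ [a _ <-]; have := sP _ (G2 a); rewrite /q2 /= dotDr dotZr; lra.
Qed.

End Duality.

(** * Relative semicontinuity, the time barrier, traces on the interface *)

Lemma usc_on_within {R : realType} {X : topologicalType} (D : set X) (f : X -> R) :
  usc_on D f -> usc_within D f.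
Proof.
move=> fu x Dx e e0.
have fx : ((- f x - e)%:E < (- f x)%:E)%E by rewrite lte_fin; lra.
have [V xV VP] := fu x _ fx.
have {xV} xV : within D (nbhs x) V by rewrite nbhs_subspace_in.
by apply: filterS xV => y /VP; rewrite lte_fin; lra.
Qed.

Lemma usc_within_at {R : realType} {X : topologicalType} (K : set X) (f : X -> R) :
  (forall x, K x -> {for x, continuous f}) -> usc_within K f.
Proof.
move=> fc x Kx e e0; have /cvgr_lt H := fc x Kx.
have : f x < f x + e by lra.
by move=> /H; apply: filterS.
Qed.

Lemma bounded_on_le {R : realType} {X : Type} {V : normedModType R} (D : set X) (f : X -> V) :
  [bounded f z | z in D] -> exists M : R, forall z, D z -> `|f z| <= M.
Proof.
by case=> M [_ H]; exists (M + 1) => z Dz; apply: H => //; rewrite ltrDl.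
Qed.

Section Jets.
Context {R : realType}.

(** With [d] the time increment, the remainder is exactly [c d^2 / (a^2 (a - d))]; the restriction
    [d < a / 2] bounds it by [2 c d^2 / a^3]. *)
Lemma superjet_barrier {m} (D : set ('rV[R]_m * R)) (c t0 : R) Z : 0 < c -> Z.2 < t0 ->
  superjet D (fun W => c / (t0 - W.2)) Z (0, c / (t0 - Z.2) ^+ 2).
Proof.
move=> c0 Zt; set a := t0 - Z.2; have a0 : 0 < a by rewrite subr_gt0.
exists (2 * c / a ^+ 3).
have h : `|Z - Z| < a / 2 by rewrite subrr normr0 divr_gt0.
apply: filterS (near_norm_lt h) => W Wa _.
have : `|W.2 - Z.2| < a / 2 by apply: le_lt_trans Wa; rewrite prod_normE le_max lexx orbT.
rewrite ltr_norml => /andP[_ Wa2].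
set d := W.2 - Z.2 in Wa2.
have aW : a / 2 < t0 - W.2 by rewrite /a /d in Wa2 *; lra.
have -> : pd (0, c / a ^+ 2) (W - Z) = c / a ^+ 2 * d.
  by rewrite /pd /= (_ : dot 0 _ = 0) ?add0r // /dot big1 // => i _; rewrite mxE mul0r.
have d2 : d ^+ 2 <= pd (W - Z) (W - Z) by rewrite /pd -expr2 lerDr dot_ge0.
have aWE : t0 - W.2 = a - d by rewrite /a /d; ring.
rewrite aWE in aW *.
have -> : c / (a - d) = c / a + c / a ^+ 2 * d + c / (a - d) / a ^+ 2 * d ^+ 2.
  by field; rewrite !lt0r_neq0 //; lra.
rewrite lerD2l.
have ad0 : 0 < a - d by lra.
have h1 : c / (a - d) / a ^+ 2 <= 2 * c / a ^+ 3.
  have -> : 2 * c / a ^+ 3 = (2 * c / a) / a ^+ 2 by field; rewrite lt0r_neq0.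
  rewrite ler_wpM2r ?invr_ge0 ?sqr_ge0 // ler_pdivrMr //.
  have -> : c = 2 * c / a * (a / 2) by field; rewrite lt0r_neq0.
  rewrite [2 * (2 * c / a * (a / 2))](_ : _ = 2 * c); last by field; rewrite lt0r_neq0.
  by rewrite ler_wpM2l ?divr_ge0 ?mulr_ge0 ?(ltW c0) ?(ltW a0) ?(ltW aW).
by apply: ler_pM; rewrite ?sqr_ge0 // !divr_ge0 ?sqr_ge0 // ltW.
Qed.

Lemma modulus_small (m : R -> R) (k e : R) : modulus m -> 0 < k -> 0 < e ->
  exists2 d : R, 0 < d & forall s : R, 0 <= s -> s < d -> m (k * s) <= e.
Proof.
move=> [m0 _ mlim] k0 e0.
have /cvgrPdist_le /(_ e e0) := mlim; rewrite near_withinE => -[/= d d0 dP].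
exists (d / k); first by rewrite divr_gt0.
(* The right limit at 0 does not see the value at 0, which [m 0 = 0] supplies. *)
move=> s s0 sd; have [->|sn0] := eqVneq s 0; first by rewrite mulr0 m0 ltW.
have ks : 0 < k * s by rewrite mulr_gt0 // lt_neqAle eq_sym sn0.
have := dP (k * s); rewrite /= !sub0r !normrN gtr0_norm // => H.
apply: le_trans (ler_norm _) _; apply: H => //.
by move: sd; rewrite ltr_pdivlMr // mulrC.
Qed.

End Jets.

Section HalfDomains.
Context {R : realType} {n : nat}.
Local Notation V := 'rV[R]_(n + 1).
Local Notation X := (V * R)%type.

(** A small step along [e *: eN] stays in the open set and enters the chosen side. Interface points
    thus lie in both closures, where the data of both sides obey their bounds. *)
Lemma closed_side_closure (Omega : set V) (x : V) (e : R) : open Omega -> Omega x ->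
  e ^+ 2 = 1 -> 0 <= e * dot x eN -> closure ([set y | 0 < e * dot y eN] `&` Omega) x.
Proof.
move=> Oo Ox e1 xe W xW.
have /nbhs_ballP [d /= d0 dP] : nbhs x (W `&` Omega) by apply: filterI => //; exact: open_nbhs_nbhs.
have d20 : 0 < d / 2 by rewrite divr_gt0.
have en : `|e| = 1 by apply/eqP; rewrite -sqrp_eq1 // real_normK ?num_real // e1.
pose y := x + (d / 2 * e) *: eN.
have [Wy Oy] : (W `&` Omega) y.
  apply: dP; rewrite -ball_normE /ball_ /= /y opprD addNKr normrN normrZ normrM en mulr1 gtr0_norm //.
  apply: (@le_lt_trans _ _ (d / 2)); last by lra.
  by rewrite ler_piMr ?eN_norm_le1 ?(ltW d20).
exists y; split => //; split => //=.
rewrite /y dotDl dotZl dot_eN_eN mulr1 mulrDr mulrCA -expr2 e1 mulr1; lra.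
Qed.

(** The embedding [f] is continuous and preserves [pd], so the quadratic bound pulls back with the
    same constant. *)
Lemma superjet_on_interface (u : X -> R) (Z P : X) (D : set ('rV[R]_n * R)) :
  dot Z.1 eN = 0 -> dot P.1 eN = 0 ->
  superjet [set W | dot W.1 eN = 0] u Z P ->
  superjet D (fun W => u (tang W.1, W.2)) (lsubmx Z.1, Z.2) (lsubmx P.1, P.2).
Proof.
move=> Z0 P0 [C uC]; exists C.
pose f (W : 'rV[R]_n * R) : X := (tang W.1, W.2).
have fZ : f (lsubmx Z.1, Z.2) = Z by rewrite /f /= tang_lsubmx //; case: (Z).
have fn (W W' : 'rV[R]_n * R) : `|f W - f W'| <= `|W - W'|.
  rewrite !prod_normE ge_max !le_max lexx orbT andbT; apply/orP; left.
  rewrite /= -tangN -tangD; apply: norm_le_coord => // i.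
  rewrite /tang; case: (splitP i) => j ij.
    have -> : i = lshift 1 j by apply: val_inj.
    by rewrite row_mxEl coord_le_norm.
  have -> : i = rshift n j by apply: val_inj.
  by rewrite row_mxEr mxE normr0.
have fc : continuous_at (lsubmx Z.1, Z.2) f.
  apply/cvgrPdist_lt => e e0.
  have h : `|(lsubmx Z.1, Z.2) - (lsubmx Z.1, Z.2)| < e by rewrite subrr normr0.
  by apply: filterS (near_norm_lt h) => W; rewrite distrC; apply: le_lt_trans.
have {}uC : nbhs (f (lsubmx Z.1, Z.2)) (fun W => dot W.1 eN = 0 ->
   u W <= u Z + pd P (W - Z) + C * pd (W - Z) (W - Z)).
  by rewrite fZ.
have uf : \forall W \near (lsubmx Z.1, Z.2), dot (f W).1 eN = 0 ->
   u (f W) <= u Z + pd P (f W - Z) + C * pd (f W - Z) (f W - Z).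
  exact: (fc _ uC).
apply: filterS uf => W /(_ (dot_tang_eN _)) H _.
have fB A A' : f A - f A' = f (A - A') by rewrite /f /= tangD tangN.
have fpd A A' : pd (f A) (f A') = pd A A' by rewrite /pd /= dot_tang.
have fP : P = f (lsubmx P.1, P.2) by rewrite /f /= tang_lsubmx //; case: (P).
by move: H; rewrite -{1 2 3 4}fZ fB {1}fP !fpd.
Qed.

End HalfDomains.

(** * The comparison argument *)

Section LocalComparison.
Context {R : realType} {n : nat} {A1 A2 : metricType R}.
Local Notation V := 'rV[R]_(n + 1).
Local Notation X := (V * R)%type.
Context (Omega : set V) (T t0 h : R).
Context (b1 : V -> R -> A1 -> V) (b2 : V -> R -> A2 -> V).
Context (l1 : V -> R -> A1 -> R) (l2 : V -> R -> A2 -> R).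
Context (Mb Lb Ml : R) (ml : R -> R) (delta : R) (u v : X -> R).
Hypothesis Omega_open : open Omega.
Hypotheses (h_gt0 : 0 < h) (h_lt : h < t0) (t0_lt : t0 < T).
Hypothesis C1_1 : cond_C1 (closure (Omega1 Omega)) T b1 Mb Lb.
Hypothesis C1_2 : cond_C1 (closure (Omega2 Omega)) T b2 Mb Lb.
Hypothesis ml_modulus : modulus ml.
Hypothesis C2_1 : cond_C2 (closure (Omega1 Omega)) T l1 Ml ml.
Hypothesis C2_2 : cond_C2 (closure (Omega2 Omega)) T l2 Ml ml.
Hypothesis C3_1 : cond_C3 (closure (Omega1 Omega)) T b1 l1.
Hypothesis C3_2 : cond_C3 (closure (Omega2 Omega)) T b2 l2.
Hypothesis delta_gt0 : 0 < delta.
Hypothesis C4_1 : cond_C4 (Gamma Omega) T b1 delta.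
Hypothesis C4_2 : cond_C4 (Gamma Omega) T b2 delta.
Local Notation Q := (cyl Omega t0 h).
Hypothesis u_usc : usc_within Q u.
Hypothesis v_lsc : usc_within Q (fun Z => - v Z).
Hypothesis u_sub : subsolution Omega t0 h b1 b2 l1 l2 u.
Hypothesis v_super : supersolution Omega t0 h b1 b2 l1 l2 v.
Context (alpha1 : A1) (alpha2 : A2).
Context (c : R) (Z1 : X).
Hypotheses (c_gt0 : 0 < c) (QZ1 : Q Z1).
Hypothesis Z1_max : forall Z, Q Z ->
  u Z - v Z - c / (t0 - Z.2) <= u Z1 - v Z1 - c / (t0 - Z1.2).
Implicit Types (Z P : X) (i : bool).

Let E : X := (eN, 0).
Let F i : X -> X -> R :=
  if i then evolution_hamiltonian b1 l1 else evolution_hamiltonian b2 l2.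
Let dim : R := (n + 1)%:R.
Let L := dim * `|Lb| * (dim + 1).
Let M := dim * Mb + 1.
Let mu s := ml ((dim + 1) * s).
Let D i := closure (if i then Omega1 Omega else Omega2 Omega).
Let eta := c / (2 * h ^+ 2).

Lemma pd_normal Z : pd Z E = dot Z.1 eN.
Proof. by rewrite /pd /= mulr0 addr0. Qed.

Lemma normal_unit : pd E E = 1.
Proof. by rewrite pd_normal dot_eN_eN. Qed.

Lemma time_bounds Z : Q Z -> t0 - h < Z.2 /\ Z.2 < t0.
Proof. by case=> _ /=; rewrite in_itv /= => /andP. Qed.

Lemma data_closed_side i Z : Q Z -> on_closed_side E i Z -> in_data (D i) T Z.
Proof.
move=> QZ; have [OZ _] := QZ; have [tl tr] := time_bounds QZ.
rewrite /on_closed_side pd_normal => Zi; split; last first.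
  by have := h_lt; have := t0_lt; lra.
have i2 : (side_sign i : R) ^+ 2 = 1 by rewrite /side_sign; case: (i); rewrite ?sqrrN expr1n.
have := closed_side_closure Omega_open OZ i2 Zi; rewrite /D /side_sign.
case: (i); rewrite /Omega1 /Omega2; first by under eq_set do rewrite mul1r.
by under eq_set do rewrite mulN1r oppr_gt0.
Qed.

Lemma side_cyl i Z : Q Z -> on_side E i Z ->
  cyl (if i then Omega1 Omega else Omega2 Omega) t0 h Z.
Proof.
case=> OZ tZ; rewrite /on_side /side_sign pd_normal; case: i => Zi; split => //; split => //=.
  by move: Zi; rewrite mul1r.
by move: Zi; rewrite mulN1r oppr_gt0.
Qed.

Lemma flat_cyl Z : Q Z -> pd Z E = 0 -> cyl (Gamma Omega) t0 h Z.
Proof. by case=> OZ tZ; rewrite pd_normal => Z0; split => //; split. Qed.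

Lemma u_jet_side i Z P : Q Z -> on_side E i Z -> superjet setT u Z P -> F i Z P <= 0.
Proof.
move=> QZ Zi /(superjetW (@subsetT _ Q)) uP; have [s1 s2 _ _] := u_sub.
have := side_cyl QZ Zi; rewrite /F; case: (i) => DZ.
  exact: (visc_sub_superjet s1 DZ uP).
exact: (visc_sub_superjet s2 DZ uP).
Qed.

Lemma u_jet_flat Z P : Q Z -> pd Z E = 0 -> superjet setT u Z P -> exists i, F i Z P <= 0.
Proof.
move=> QZ Z0 /(superjetW (@subsetT _ Q)) uP; have [_ _ s3 _] := u_sub.
have := visc_sub_superjet s3 (flat_cyl QZ Z0) uP; rewrite /= minEle.
by case: ifP => _ H; [exists true | exists false].
Qed.

Lemma v_jet_side i Z P : Q Z -> on_side E i Z ->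
  superjet setT (fun W => - v W) Z (- P) -> 0 <= F i Z P.
Proof.
move=> QZ Zi /(superjetW (@subsetT _ Q)) vP; have [s1 s2 _] := v_super.
have := side_cyl QZ Zi; rewrite /F; case: (i) => DZ.
  exact: (visc_super_superjet s1 DZ vP).
exact: (visc_super_superjet s2 DZ vP).
Qed.

Lemma v_jet_flat Z P : Q Z -> pd Z E = 0 ->
  superjet setT (fun W => - v W) Z (- P) -> exists i, 0 <= F i Z P.
Proof.
move=> QZ Z0 /(superjetW (@subsetT _ Q)) vP; have [_ _ s3] := v_super.
have := visc_super_superjet s3 (flat_cyl QZ Z0) vP; rewrite /= maxEle.
by case: ifP => _ H; [exists false | exists true].
Qed.

Lemma flat_closed_side i Z : pd Z E = 0 -> on_closed_side E i Z.
Proof. by rewrite /on_closed_side => ->; rewrite mulr0. Qed.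

Lemma u_jet_tangential Z P : Q Z -> pd Z E = 0 -> pd P E = 0 ->
  superjet [set W | pd W E = 0] u Z P ->
  exists s : R, forall i, F i Z (P + s *: E) <= 0.
Proof.
move=> QZ Z0 P0 uP; have [_ _ _ s4] := u_sub.
have GZ := flat_cyl QZ Z0.
have Z0' : dot Z.1 eN = 0 by rewrite -pd_normal.
have P0' : dot P.1 eN = 0 by rewrite -pd_normal.
have tZ : tang (lsubmx Z.1) = Z.1 by exact: tang_lsubmx.
have tP : tang (lsubmx P.1) = P.1 by exact: tang_lsubmx.
have uP' : superjet [set W : X | dot W.1 eN = 0] u Z P.
  by apply: superjetW uP => W /=; rewrite pd_normal.
have GZ' : cyl (Gamma' Omega) t0 h (lsubmx Z.1, Z.2).
  by case: GZ => g1 g2; split => //; rewrite /Gamma' /= tZ.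
have := visc_sub_superjet s4 GZ' (superjet_on_interface _ Z0' P0' uP').
rewrite /= tZ => HTle.
have D1 := data_closed_side QZ (flat_closed_side true Z0).
have D2 := data_closed_side QZ (flat_closed_side false Z0).
have G1 : Gamma Omega Z.1 by case: GZ.
have TZ : 0 <= Z.2 <= T by case: D1.
have [s [s1 s2]] := tangential_duality C1_1 C1_2 C2_1 C2_2 C3_1 C3_2 D1 D2 delta_gt0
  (C4_1 G1 TZ) (C4_2 G1 TZ) (lsubmx P.1).
exists s => i; rewrite /F /evolution_hamiltonian.
by move: s1 s2; rewrite tP; case: i; rewrite /= scaler0 addr0; lra.
Qed.

Let barrier (W : X) : R := c / (t0 - W.2) + pd (W - Z1) (W - Z1).
Let barrier_grad Z : X := (0, c / (t0 - Z.2) ^+ 2) + 2 *: (Z - Z1).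
Let u' (W : X) : R := u W - barrier W.

Lemma u_jet_shift (S : set X) Z P : Q Z -> superjet S u' Z P ->
  superjet S u Z (P + barrier_grad Z).
Proof.
move=> QZ uP; have [_ tr] := time_bounds QZ.
have jb := superjetD (superjet_barrier S c_gt0 tr) (superjet_sq S Z1 Z).
have := superjetD uP jb.
by rewrite (_ : u' \+ _ = u) //; apply/funext => W; rewrite /u' /barrier /=; ring.
Qed.

Lemma F_lip_jet i Z P P' : Q Z -> on_closed_side E i Z ->
  F i Z P <= F i Z P' + M * `|P - P'|.
Proof.
move=> QZ Zi; have := data_closed_side QZ Zi; rewrite /F; case: (i) => DZ.
  exact: (evolution_lip_jet alpha1 C1_1 C2_1 _ _ DZ).
exact: (evolution_lip_jet alpha2 C1_2 C2_2 _ _ DZ).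
Qed.

Lemma eta_gt0 : 0 < eta.
Proof. by rewrite divr_gt0 // mulr_gt0 // exprn_gt0. Qed.

Lemma M_ge1 : 1 <= M.
Proof.
have : 0 <= Mb.
  have [[i Zi]|[_ Zi]] := side_cases E Z1; last first.
    exact: (Mb_ge0 alpha1 C1_1 (data_closed_side QZ1 (Zi true))).
  have := data_closed_side QZ1 (on_sideW Zi); case: (i) => DZ.
    exact: (Mb_ge0 alpha1 C1_1 DZ).
  exact: (Mb_ge0 alpha2 C1_2 DZ).
by move=> Mb0; rewrite /M lerDr mulr_ge0.
Qed.

(** As [t0 - Z.2 < h], the barrier contributes at least [c / h^2 = 2 eta]. Half of it remains as
    strictness; the other half pays for the gradient of the square. *)
Lemma F_shift i Z P (r : R) : Q Z -> on_closed_side E i Z -> `|Z - Z1| <= r ->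
  M * (2 * r) <= eta -> F i Z (P + barrier_grad Z) <= 0 -> F i Z P <= - eta.
Proof.
move=> QZ Zi Zr rs H; have := F_lip_jet P (P + 2 *: (Z - Z1)) QZ Zi.
rewrite opprD addNKr normrN normrZ ger0_norm // => H1.
have H2 : M * (2 * `|Z - Z1|) <= M * (2 * r).
  by rewrite ler_wpM2l ?(le_trans _ M_ge1) // ler_wpM2l.
have H3 : F i Z (P + barrier_grad Z) = c / (t0 - Z.2) ^+ 2 + F i Z (P + 2 *: (Z - Z1)).
  rewrite /F; case: (i); rewrite /evolution_hamiltonian /barrier_grad /= add0r; ring.
have [tl tr] := time_bounds QZ.
have H4 : 2 * eta <= c / (t0 - Z.2) ^+ 2.
  have -> : 2 * eta = c / h ^+ 2 by rewrite /eta; field; rewrite lt0r_neq0.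
  have ht := h_gt0.
  rewrite ler_wpM2l ?(ltW c_gt0) // lef_pV2 ?posrE ?exprn_gt0 //; last by lra.
  by rewrite ler_pXn2r ?nnegrE //; lra.
move: H1 H2 H H4 rs; rewrite H3; set f := F _ _ _; set g := F _ _ _; set k := c / _.
set m1 := M * _; set m2 := M * _; lra.
Qed.

Lemma F_lip i Z Z' P : Q Z -> Q Z' -> on_closed_side E i Z -> on_closed_side E i Z' ->
  F i Z P <= F i Z' P + L * `|Z - Z'| * `|P| + mu `|Z - Z'|.
Proof.
move=> QZ QZ' Zi Z'i; have := data_closed_side QZ Zi; have := data_closed_side QZ' Z'i.
rewrite /F; case: (i) => DZ' DZ.
  exact: (evolution_lip alpha1 C1_1 ml_modulus C2_1 P DZ DZ').
exact: (evolution_lip alpha2 C1_2 ml_modulus C2_2 P DZ DZ').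
Qed.

Lemma F_qconvex i Z P P' (t k : R) : Q Z -> on_closed_side E i Z -> 0 <= t <= 1 ->
  F i Z P <= k -> F i Z P' <= k -> F i Z ((1 - t) *: P + t *: P') <= k.
Proof.
move=> QZ Zi; have := data_closed_side QZ Zi; rewrite /F; case: (i) => DZ.
  exact: (evolution_qconvex alpha1 C1_1 C2_1 DZ).
exact: (evolution_qconvex alpha2 C1_2 C2_2 DZ).
Qed.

Lemma F_coercive i Z P (s : R) : pd Z1 E = 0 -> Q Z -> on_closed_side E i Z ->
  dim * (`|Lb| * ((dim + 1) * `|Z - Z1|)) <= delta / 2 ->
  delta / 2 * `|s| <= (dim * Mb + Ml + 1) * (1 + `|P|) + F i Z (P + s *: E).
Proof.
move=> Z10 QZ Zi close; have := data_closed_side QZ Zi.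
have := data_closed_side QZ1 (flat_closed_side i Z10).
have [G1 _] := flat_cyl QZ1 Z10.
have TZ1 : 0 <= Z1.2 <= T by have [] := data_closed_side QZ1 (flat_closed_side i Z10).
rewrite /F; case: (i) => DZ1 DZ.
  exact: (evolution_coercive alpha1 C1_1 C2_1 P s DZ DZ1 delta_gt0 (C4_1 G1 TZ1) close (eN_norm_le1 (n := n))).
exact: (evolution_coercive alpha2 C1_2 C2_2 P s DZ DZ1 delta_gt0 (C4_2 G1 TZ1) close (eN_norm_le1 (n := n))).
Qed.

Lemma cball_in_cyl : exists2 r : R, 0 < r & cball Z1 r `<=` Q.
Proof.
have [OZ tZ] := QZ1.
have h1 : nbhs Z1 (fun Z : X => Omega Z.1).
  exact: (@continuous_fst V R Z1 _ (open_nbhs_nbhs (conj Omega_open OZ))).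
have h2 : nbhs Z1 (fun Z : X => `]t0 - h, t0[%classic Z.2).
  by apply: (@continuous_snd V R Z1 _ (open_nbhs_nbhs (conj _ tZ))); exact: itv_open.
have /nbhs_ballP [d /= d0 dQ] : nbhs Z1
    ((fun Z : X => Omega Z.1) `&` (fun Z : X => `]t0 - h, t0[%classic Z.2)).
  exact: filterI h1 h2.
exists (d / 2); first by rewrite divr_gt0.
move=> Z Zd; apply: (dQ Z); rewrite -ball_normE /ball_ /= distrC.
by apply: le_lt_trans Zd _; rewrite ltr_pdivrMr // ltr_pMr // ltr1n.
Qed.

Lemma barrier_usc (S : set X) : S `<=` Q -> usc_within S (fun W => - barrier W).
Proof.
move=> SQ; apply: usc_within_at => Z SZ; have [_ tr] := time_bounds (SQ _ SZ).
have sc : {for Z, continuous (fun W : X => t0 - W.2)}.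
  by apply: cvgB; [exact: cvg_cst | exact: cvg_snd].
have dc : continuous (fun W : X => W - Z1).
  by move=> W; apply: cvgB; [exact: cvg_id | exact: cvg_cst].
apply: cvgN; apply: cvgD; last exact: (continuous_pd dc dc).
by apply: cvgMr; apply: cvgV => //; rewrite subr_eq0 gt_eqF.
Qed.

Lemma penalized_max Z : Q Z -> u' Z1 - v Z1 <= u' Z - v Z -> Z = Z1.
Proof.
move=> QZ; have := Z1_max QZ; rewrite /u' /barrier subrr pd0l addr0 => h1 h2.
apply/eqP; rewrite -subr_eq0; apply/eqP; apply: pd_eq0.
by have := pd_ge0 (Z - Z1); lra.
Qed.

Lemma local_comparison : False.
Proof.
have eta0 := eta_gt0; have M1 := M_ge1; have d0 := delta_gt0.
have [rQ rQ0 BQ] := cball_in_cyl.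
pose K := dim * (`|Lb| * (dim + 1)).
have dim0 : 0 <= dim by exact: ler0n.
have K0 : 0 <= K by rewrite !mulr_ge0 // addr_ge0.
have L0 : 0 <= L by rewrite !mulr_ge0 // addr_ge0.
have [r [[r0 rrQ] [reta rdelta rside]]] : exists r : R, (0 < r /\ r <= rQ) /\
    [/\ M * (2 * r) <= eta, K * r <= delta / 2 &
      pd Z1 E != 0 -> (n + 1).+1%:R * r < `|pd Z1 E|].
  pose k : R := if pd Z1 E == 0 then 1 else `|pd Z1 E| / (2 * (n + 1).+1%:R).
  have k0 : 0 < k by rewrite /k; case: eqP => // /eqP ?; rewrite divr_gt0 ?normr_gt0 ?mulr_gt0.
  (* The entries keep the ball inside the cylinder, keep it on one side if [Z1] is off the
     interface, limit the price of the square to [eta], and preserve the normal controllability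
     available at an interface point [Z1]. *)
  pose r : R := Num.min rQ (Num.min k (Num.min (eta / (2 * M)) (delta / (2 * (K + 1))))).
  have M20 : 0 < 2 * M by lra.
  have K20 : 0 < 2 * (K + 1) by lra.
  have r0 : 0 < r by rewrite !lt_min rQ0 k0 (divr_gt0 eta0 M20) (divr_gt0 d0 K20).
  exists r; split; [|split].
  - by split => //; rewrite ge_min lexx.
  - have : r <= eta / (2 * M) by rewrite !ge_min lexx !orbT.
    rewrite ler_pdivlMr //; apply: le_trans.
    by rewrite mulrCA (mulrC M) mulrCA.
  - have : r <= delta / (2 * (K + 1)) by rewrite !ge_min lexx !orbT.
    by rewrite ler_pdivlMr // => H; rewrite ler_pdivlMr //; lra.
  - move=> /negPf Z10; have : r <= k by rewrite !ge_min lexx !orbT.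
    rewrite /k Z10 ler_pdivlMr ?mulr_gt0 // => H.
    have : 0 < r * (n + 1).+1%:R by rewrite mulr_gt0.
    by move: H; rewrite mulrCA (mulrC r); lra.
have BrQ : cball Z1 r `<=` Q by move=> Z Zr; apply: BQ; exact: le_trans Zr rrQ.
have Br Z : `|Z - Z1| < r -> cball Z1 r Z := @ltW _ _ _ _.
have uu : usc_within (cball Z1 r) u'.
  exact: usc_withinD (usc_withinW BrQ u_usc) (barrier_usc BrQ).
have vu := usc_withinW BrQ v_lsc.
have mx Z : cball Z1 r Z -> u' Z1 - v Z1 <= u' Z - v Z -> Z = Z1.
  by move=> /BrQ; exact: penalized_max.
have muP e : 0 < e -> exists2 d : R, 0 < d & forall s : R, 0 <= s -> s < d -> mu s <= e.
  by apply: modulus_small ml_modulus _; rewrite ltr_wpDl.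
have shift i Z P : `|Z - Z1| < r -> on_closed_side E i Z ->
    F i Z (P + barrier_grad Z) <= 0 -> F i Z P <= - eta.
  by move=> Zr Zi; apply: F_shift reta => //; [exact: BrQ (Br _ Zr) | exact: ltW].
have u_side i Z P : `|Z - Z1| < r -> on_side E i Z ->
    superjet setT u' Z P -> F i Z P <= - eta.
  move=> Zr Zi uP; have QZ := BrQ _ (Br _ Zr); apply: shift => //; first exact: on_sideW.
  exact: u_jet_side QZ Zi (u_jet_shift QZ uP).
have [Z10|Z10] := eqVneq (pd Z1 E) 0; last first.
  have [i Z1i] : exists i, on_side E i Z1 by case: (side_cases E Z1) => // -[]; move/eqP: Z10.
  have Bi Z : cball Z1 r Z -> on_side E i Z.
    move=> Zr; apply: same_side Z1i _; apply: le_lt_trans (rside Z10).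
    have -> : pd Z E - pd Z1 E = pd (Z - Z1) E by rewrite !pdE.
    by apply: le_trans (pd_unit_le_norm normal_unit _) _; rewrite ler_wpM2l.
  apply: (@interior_comparison _ _ (F i) u' v Z1 r eta L mu r0 eta0 L0 muP _ uu vu mx).
  - move=> Z Y P BZ BY; apply: F_lip; [exact: BrQ|exact: BrQ| |]; exact: on_sideW (Bi _ _).
  - by move=> Z P Zr; apply: (u_side i Z P Zr); exact: Bi (Br _ Zr).
  - move=> Z P Zr; apply: v_jet_side; [exact: BrQ (Br _ Zr) | exact: Bi (Br _ Zr)].
have Ml0 : 0 <= Ml.
  have DZ := data_closed_side QZ1 (flat_closed_side true Z10).
  exact: le_trans (normr_ge0 _) (l_norm_le C2_1 alpha1 DZ).
have M0 : 0 <= M := le_trans ler01 M1.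
have M00 : 0 <= dim * Mb + Ml + 1 by move: M1; rewrite /M; lra.
have d20 : 0 < delta / 2 by rewrite divr_gt0.
apply: (@interface_comparison _ _ E normal_unit F u' v Z1 r eta L M
   (dim * Mb + Ml + 1) (delta / 2) mu r0 eta0 L0 M0 M00 d20 muP _ _ _ _ uu vu mx u_side).
- by move=> i Z Y P BZ BY; apply: F_lip; exact: BrQ.
- by move=> i Z P P' BZ; apply: F_lip_jet; exact: BrQ.
- by move=> i Z P P' t k BZ; apply: F_qconvex; exact: BrQ.
- move=> i Z P s BZ Zi; apply: F_coercive => //; first exact: BrQ.
  apply: le_trans rdelta; rewrite -mulrA -mulrA ler_wpM2l // ler_wpM2l //.
  by rewrite ler_wpM2l // addr_ge0.
- move=> Z P Zr Z0 uP; have QZ := BrQ _ (Br _ Zr).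
  have [i iP] := u_jet_flat QZ Z0 (u_jet_shift QZ uP).
  by exists i; apply: shift => //; exact: flat_closed_side.
- move=> Z P Zr Z0 P0 uP; have QZ := BrQ _ (Br _ Zr).
  (* [Z] and [Z1] both lie on the interface and the singular term depends on time alone, so the
     added gradient is tangential. *)
  have gP : pd (P + barrier_grad Z) E = 0.
    rewrite /barrier_grad !pdE P0 Z0 Z10 subrr mulr0 addr0 add0r.
    by rewrite pd_normal /= /dot big1 // => i _; rewrite mxE mul0r.
  have [s sP] := u_jet_tangential QZ Z0 gP (u_jet_shift QZ uP).
  by exists s => i; apply: shift => //; [exact: flat_closed_side | rewrite addrAC].
- by move=> i Z P Zr; apply: v_jet_side; exact: BrQ (Br _ Zr).
- by move=> Z P Zr; apply: v_jet_flat; exact: BrQ (Br _ Zr).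
Qed.

End LocalComparison.

(** * The cylinder, its parabolic boundary, and the conclusion *)

Lemma bounded_closure_compact {R : realType} {m : nat} (S : set 'rV[R]_m) :
  bounded_set S -> compact (closure S).
Proof.
move=> /bounded_on_le [M SM]; apply: bounded_closed_compact; last exact: closed_closure.
have cl : closed (cball (0 : 'rV[R]_m) (`|M| + 1)).
  rewrite (_ : cball _ _ = closed_ball (0 : 'rV[R]_m) (`|M| + 1)); first exact: closed_ball_closed.
  rewrite closed_ballE ?ltr_wpDl //; apply/seteqP; split => x /=.
    by rewrite /closed_ball_ /cball /= distrC.
  by rewrite /closed_ball_ /cball /= distrC.
have SB : S `<=` cball (0 : 'rV[R]_m) (`|M| + 1).
  move=> x /SM xM; rewrite /cball /= subr0; apply: le_trans xM _.
  by apply: le_trans (ler_norm _) _; rewrite lerDl.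
exists (`|M| + 1); split; first by rewrite num_real.
move=> k kM x /(closure_subset SB); rewrite -(closure_id _).1 // /cball /= subr0 => xM.
exact: le_trans xM (ltW kM).
Qed.

Lemma itv_subset_closure {R : realType} (t0 h t : R) : 0 < h ->
  t0 - h <= t -> t <= t0 -> closure `]t0 - h, t0[ t.
Proof.
move=> h0 tl tr W /nbhs_ballP [d /= d0 dW].
pose e : R := Num.min 1 (d / h).
have e0 : 0 < e by rewrite lt_min ltr01 divr_gt0.
have e1 : e <= 1 by rewrite ge_min lexx.
have eh : e * h <= d by rewrite -ler_pdivlMr // ge_min lexx orbT.
have eh0 : 0 < e * h by rewrite mulr_gt0.
have p1 : 0 <= (1 - e) * (t - (t0 - h)) by rewrite mulr_ge0 //; lra.
have p2 : 0 <= (1 - e) * (t0 - t) by rewrite mulr_ge0 //; lra.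
have p3 : 0 <= e * (t - (t0 - h)) by rewrite mulr_ge0 ?(ltW e0) //; lra.
have p4 : 0 <= e * (t0 - t) by rewrite mulr_ge0 ?(ltW e0) //; lra.
exists (t + e * (t0 - h / 2 - t)); split.
  by rewrite /= in_itv /=; apply/andP; split; lra.
by apply: dW; rewrite -ball_normE /ball_ /= opprD addNKr normrN ltr_norml; apply/andP; split; lra.
Qed.

Lemma closure_cyl {R : realType} {m : nat} (S : set 'rV[R]_m) (t0 h : R) : 0 < h ->
  closure S `*` `[t0 - h, t0] `<=` closure (cyl S t0 h).
Proof.
move=> h0 [x t] /= [Sx]; rewrite in_itv /= => /andP[tl tr] W [[W1 W2]] /= [xW1 tW2] WW.
have [y [Sy W1y]] := Sx _ xW1.
have tI : closure `]t0 - h, t0[ t by exact: itv_subset_closure.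
have [s [Is W2s]] := tI _ tW2.
by exists (y, s); split; [split | exact: WW].
Qed.

Lemma pbdry_closure {R : realType} {n : nat} (Omega : set 'rV[R]_(n + 1)) (t0 h : R) :
  0 < h -> pbdry Omega t0 h `<=` closure (cyl Omega t0 h).
Proof.
move=> h0 Z [[OZ tZ]|[[clZ _] tZ]]; apply: closure_cyl => //.
split; first exact: subset_closure.
by rewrite /= in_itv /= (tZ : Z.2 = _); apply/andP; split; lra.
Qed.

Lemma cyl_or_pbdry {R : realType} {n : nat} (Omega : set 'rV[R]_(n + 1)) (t0 h : R) Z :
  open Omega -> closure Omega Z.1 -> t0 - h <= Z.2 < t0 ->
  cyl Omega t0 h Z \/ pbdry Omega t0 h Z.
Proof.
move=> Oo clZ /andP[tl tr]; have [OZ|nOZ] := pselect (Omega Z.1); last first.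
  right; right; split; last by rewrite /= in_itv /= tl ltW.
  by split => // /interior_subset.
move: tl; rewrite le_eqVlt => /orP[/eqP tE|tl]; last first.
  by left; split => //; rewrite /= in_itv /= tl.
by right; left; split.
Qed.

(* The barrier [c / (t0 - t)] keeps the maximum away from the final time. *)
Lemma barrier_max {R : realType} {n : nat} (Omega : set 'rV[R]_(n + 1)) (t0 h k : R)
    (u v : 'rV[R]_(n + 1) * R -> R) Z0 :
  open Omega -> bounded_set Omega -> 0 < h -> 0 <= k ->
  [bounded u z | z in closure (cyl Omega t0 h)] ->
  [bounded v z | z in closure (cyl Omega t0 h)] ->
  usc_within (closure (cyl Omega t0 h)) u ->
  usc_within (closure (cyl Omega t0 h)) (fun Z => - v Z) ->
  (forall Z, pbdry Omega t0 h Z -> u Z - v Z <= k) ->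
  cyl Omega t0 h Z0 -> k < u Z0 - v Z0 ->
  exists (c : R) Z1, [/\ 0 < c, cyl Omega t0 h Z1 & forall Z, cyl Omega t0 h Z ->
    u Z - v Z - c / (t0 - Z.2) <= u Z1 - v Z1 - c / (t0 - Z1.2)].
Proof.
move=> Oo Ob h0 k0 /bounded_on_le [Mu uM] /bounded_on_le [Mv vM] uu vu bk QZ0 kZ0.
have [OZ0 /=] := QZ0; rewrite in_itv /= => /andP[tl0 tr0].
have a0 : 0 < t0 - Z0.2 by lra.
(* The barrier takes half of the excess at [Z0], so a positive excess survives. *)
pose c : R := (u Z0 - v Z0 - k) / 2 * (t0 - Z0.2).
have c0 : 0 < c by rewrite mulr_gt0 // divr_gt0 // subr_gt0.
have cE : c / (t0 - Z0.2) = (u Z0 - v Z0 - k) / 2 by rewrite /c mulfK // lt0r_neq0.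
(* [N] exceeds [u - v] on the cylinder, and after [t0 - tau] the barrier exceeds [N]. The maximum
   can therefore be sought on a compact set of earlier times. *)
pose N : R := `|Mu| + `|Mv| + 1.
have N0 : 0 < N by rewrite ltr_wpDl // addr_ge0.
pose tau := Num.min (t0 - Z0.2) (c / N).
have tau0 : 0 < tau by rewrite lt_min a0 divr_gt0.
have tauZ : tau <= t0 - Z0.2 by rewrite ge_min lexx.
have tauN : tau * N <= c by rewrite -ler_pdivlMr // ge_min lexx orbT.
pose f (Z : 'rV[R]_(n + 1) * R) := u Z - v Z - c / (t0 - Z.2).
have QcQ : cyl Omega t0 h `<=` closure (cyl Omega t0 h) by exact: subset_closure.
have late Z : cyl Omega t0 h Z -> t0 - tau < Z.2 -> f Z < k.
  move=> QZ tZ; have [_ /=] := QZ; rewrite in_itv /= => /andP[_ tr].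
  have tz0 : 0 < t0 - Z.2 by lra.
  have h1 : N < c / (t0 - Z.2).
    rewrite ltr_pdivlMr // mulrC; apply: lt_le_trans tauN.
    by rewrite ltr_pM2r //; lra.
  have := uM _ (QcQ _ QZ); have := vM _ (QcQ _ QZ); rewrite !ler_norml.
  move=> /andP[v1 v2] /andP[u1 u2]; have := ler_norm Mu; have := ler_norm Mv.
  by move: h1; rewrite /f /N; lra.
pose K := closure Omega `*` `[t0 - h, t0 - tau].
have Kc : compact K by apply: compact_setX; [exact: bounded_closure_compact | exact: segment_compact].
have KQ : K `<=` closure (cyl Omega t0 h).
  move=> Z [clZ /=]; rewrite in_itv /= => /andP[z1 z2]; apply: closure_cyl => //.
  by split => //=; rewrite in_itv /= z1; lra.
have fu : usc_within K f.
  have uv := usc_withinD (usc_withinW KQ uu) (usc_withinW KQ vu).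
  apply: (usc_withinD uv (g := fun Z => - (c / (t0 - Z.2)))).
  apply: usc_within_at => Z [_ /=]; rewrite in_itv /= => /andP[_ z2].
  apply: cvgN; apply: cvgMr; apply: cvgV; first by rewrite subr_eq0 gt_eqF //; lra.
  by apply: cvgB; [exact: cvg_cst | exact: cvg_snd].
have KZ0 : K Z0.
  by split; [exact: subset_closure | rewrite /= in_itv /=; apply/andP; split; lra].
have [Z1 [clZ1 tZ1] fmax] := usc_compact_max Kc (ex_intro _ _ KZ0) fu.
have fZ1 : k < f Z1.
  by apply: lt_le_trans (fmax _ KZ0); rewrite /f cE; lra.
move: tZ1; rewrite /= in_itv /= => /andP[z1 z2].
have z3 : Z1.2 < t0 by lra.
have QZ1 : cyl Omega t0 h Z1.
  have [//|pZ1] : cyl Omega t0 h Z1 \/ pbdry Omega t0 h Z1.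
    by apply: cyl_or_pbdry => //; rewrite z1.
  have := bk _ pZ1; have : 0 < c / (t0 - Z1.2) by rewrite divr_gt0 // subr_gt0.
  by move: fZ1; rewrite /f; lra.
exists c, Z1; split => // Z QZ; have [tZ|tZ] := leP Z.2 (t0 - tau); last first.
  by apply: le_trans (ltW (late _ QZ tZ)) (ltW fZ1).
apply: fmax; have [OZ /=] := QZ; rewrite in_itv /= => /andP[y1 y2].
by split; [exact: subset_closure | rewrite /= in_itv /= tZ ltW].
Qed.

Unset Implicit Arguments.

Theorem lemma7p7 (R : realType) (n : nat) (Omega : set 'rV[R]_(n + 1))
  (T t0 h : R) (A1 A2 : metricType R)
  (b1 : 'rV[R]_(n + 1) -> R -> A1 -> 'rV[R]_(n + 1))
  (b2 : 'rV[R]_(n + 1) -> R -> A2 -> 'rV[R]_(n + 1))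
  (l1 : 'rV[R]_(n + 1) -> R -> A1 -> R)
  (l2 : 'rV[R]_(n + 1) -> R -> A2 -> R)
  (Mb Lb Ml : R) (ml : R -> R) (delta : R)
  (u v : 'rV[R]_(n + 1) * R -> R)
  (Omega_open : open Omega) (Omega_bounded : bounded_set Omega)
  (Omega_0 : Omega 0)
  (h_gt0 : 0 < h) (h_lt : h < t0) (t0_lt : t0 < T)
  (C1_1 : cond_C1 (closure (Omega1 Omega)) T b1 Mb Lb)
  (C1_2 : cond_C1 (closure (Omega2 Omega)) T b2 Mb Lb)
  (ml_modulus : modulus ml)
  (C2_1 : cond_C2 (closure (Omega1 Omega)) T l1 Ml ml)
  (C2_2 : cond_C2 (closure (Omega2 Omega)) T l2 Ml ml)
  (C3_1 : cond_C3 (closure (Omega1 Omega)) T b1 l1)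
  (C3_2 : cond_C3 (closure (Omega2 Omega)) T b2 l2)
  (delta_gt0 : 0 < delta)
  (C4_1 : cond_C4 (Gamma Omega) T b1 delta)
  (C4_2 : cond_C4 (Gamma Omega) T b2 delta)
  (u_bounded : [bounded u z | z in closure (cyl Omega t0 h)])
  (v_bounded : [bounded v z | z in closure (cyl Omega t0 h)])
  (u_usc : usc_on (closure (cyl Omega t0 h)) u)
  (v_lsc : lsc_on (closure (cyl Omega t0 h)) v)
  (u_sub : subsolution Omega t0 h b1 b2 l1 l2 u)
  (v_super : supersolution Omega t0 h b1 b2 l1 l2 v) :
  supnorm (cyl Omega t0 h) (u \- v)^\+
    <= supnorm (pbdry Omega t0 h) (u \- v)^\+.
Proof.
set Q := cyl Omega t0 h; set f := (u \- v)^\+.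
have QQ : Q `<=` closure Q by exact: subset_closure.
have pQ : pbdry Omega t0 h `<=` closure Q by exact: pbdry_closure.
have fE z : `|f z| = Num.max (u z - v z) 0.
  by rewrite /f /funrpos ger0_norm // le_max lexx orbT.
have [Mu uM] := bounded_on_le u_bounded.
have [Mv vM] := bounded_on_le v_bounded.
(* [supnorm] is a real [sup], meaningful only for nonempty sets that are bounded above. *)
have pb : has_ubound [set `|f z| | z in pbdry Omega t0 h].
  exists (`|Mu| + `|Mv|) => _ [z /pQ zQ <-]; rewrite fE ge_max addr_ge0 // andbT.
  apply: le_trans (ler_norm _) _; apply: le_trans (ler_normB _ _) _.
  by apply: lerD; apply: le_trans (ler_norm _); [exact: uM | exact: vM].
have tI : (t0 - h / 2) \in `]t0 - h, t0[ by rewrite in_itv /=; apply/andP; split; lra.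
have k0 : 0 <= supnorm (pbdry Omega t0 h) f.
  apply: le_trans (normr_ge0 (f (0, t0 - h))) _; apply: ub_le_sup => //.
  by exists (0, t0 - h) => //; left; split.
have pk z : pbdry Omega t0 h z -> u z - v z <= supnorm (pbdry Omega t0 h) f.
  move=> pz; apply: (@le_trans _ _ `|f z|); first by rewrite fE le_max lexx.
  by apply: ub_le_sup => //; exists z.
apply: ge_sup; first by exists `|f (0, t0 - h / 2)|, (0, t0 - h / 2) => //; split.
move=> _ [z Qz <-]; rewrite fE ge_max k0 andbT leNgt; apply/negP => zk.
have uu := usc_on_within u_usc.
have vu : usc_within (closure Q) (fun Z => - v Z).
  apply: usc_on_within; rewrite /usc_on.
  by under eq_fun do rewrite opprK.
have [c [Z1 [c0 QZ1 Z1max]]] := barrier_max Omega_open Omega_bounded h_gt0 k0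
  u_bounded v_bounded uu vu pk Qz zk.
(* The control sets are inhabited: the origin lies on the interface, where [cond_C4] realizes the
   normal drift 0. *)
have G0 : Gamma Omega 0 by split => //=; rewrite dot_eN mxE.
have tT : 0 <= t0 <= T by apply/andP; split; lra.
have d0 : `[- delta, delta]%classic 0 by rewrite /= in_itv /=; apply/andP; split; lra.
have [alpha1 _ _] := C4_1 _ _ G0 tT _ d0.
have [alpha2 _ _] := C4_2 _ _ G0 tT _ d0.
exact: (local_comparison Omega_open h_gt0 h_lt t0_lt C1_1 C1_2 ml_modulus C2_1 C2_2
  C3_1 C3_2 delta_gt0 C4_1 C4_2 (usc_withinW QQ uu) (usc_withinW QQ vu) u_sub v_super
  alpha1 alpha2 c0 QZ1 Z1max).
Qed.
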